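(* Let $\sigma(x)=x\Phi(x)$ be the GeLU activation. Let $\mu_1,\mu_2\in\mathbb R$, let $\begin{pmatrix}\nu_{11}&\nu_{12}\\ \nu_{12}&\nu_{22}\end{pmatrix}$ be positive semidefinite, and write $$h_1=\frac{\mu_1}{\sqrt{1+\nu_{11}}},\qquad h_2=\frac{\mu_2}{\sqrt{1+\nu_{22}}},\qquad \rho=\frac{\nu_{12}}{\sqrt{(1+\nu_{11})(1+\nu_{22})}}.$$ Then $$\begin{aligned}K_\sigma(\mu_1,\mu_2;\nu_{11},\nu_{22},\nu_{12})={}&\left(\mu_1\nu_{12}+\mu_2\nu_{11}-\frac{\mu_1\nu_{12}\nu_{11}}{1+\nu_{11}}\right)\frac{1}{\sqrt{1+\nu_{11}}}\,\Phi_{2;1}(h_1,h_2;\rho)\\&+\left(\mu_2\nu_{12}+\mu_1\nu_{22}-\frac{\mu_2\nu_{12}\nu_{22}}{1+\nu_{22}}\right)\frac{1}{\sqrt{1+\nu_{22}}}\,\Phi_{2;1}(h_2,h_1;\rho)\\&+\frac{\nu_{11}\nu_{22}+\nu_{12}^2\left(1-\frac{\nu_{11}}{1+\nu_{11}}-\frac{\nu_{22}}{1+\nu_{22}}\right)}{\sqrt{(1+\nu_{11})(1+\nu_{22})}}\,\phi_2(h_1,h_2;\rho)\\&+(\mu_1\mu_2+\nu_{12})\,\Phi_2(h_1,h_2;\rho)-M_\sigma(\mu_1;\nu_{11})\,M_\sigma(\mu_2;\nu_{22}).\end{aligned}$$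
   Context: $\Phi$ is the standard normal CDF. $\Phi_2(h,k;\rho)=\mathbb P[Z_1\le h,Z_2\le k]$ is the bivariate normal CDF, where $(Z_1,Z_2)$ is jointly normal with zero means, unit variances and correlation $\rho$; $\phi_2(h,k;\rho)=\frac{\partial^2}{\partial h\,\partial k}\Phi_2(h,k;\rho)$ is the bivariate normal density; $\Phi_{2;1}(h,k;\rho)=\frac{\partial}{\partial h}\Phi_2(h,k;\rho)$ is the partial derivative in the first argument. $M_\sigma(\mu;\nu):=\mathbb E\,\sigma(X)$ where $X\sim\mathcal N(\mu,\nu)$. $K_\sigma(\mu_1,\mu_2;\nu_{11},\nu_{22},\nu_{12}):=\operatorname{Cov}(\sigma(X_1),\sigma(X_2))$ where $(X_1,X_2)$ is jointly normal with means $\mu_1,\mu_2$ and covariance matrix $\begin{pmatrix}\nu_{11}&\nu_{12}\\ \nu_{12}&\nu_{22}\end{pmatrix}$. *)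

(* Defs.v *)
From HB Require Import structures.
From mathcomp Require Import all_boot all_order all_algebra.
From mathcomp Require Import all_classical all_reals all_analysis.
From mathcomp Require Import measurable_realfun.
From mathcomp Require Import ring lra.

Set Implicit Arguments.
Unset Strict Implicit.
Unset Printing Implicit Defensive.

Import Order.TTheory GRing.Theory Num.Theory.
Import numFieldNormedType.Exports.

Local Open Scope classical_set_scope.
Local Open Scope ring_scope.

Definition psdmx (R : realType) (n : nat) (A : 'M[R]_n) : Prop :=
  A^T = A /\ forall x : 'cV[R]_n, 0 <= (x^T *m A *m x) 0 0.

Definition covmx2 (R : realType) (nu11 nu22 nu12 : R) : 'M[R]_(1 + 1) :=
  block_mx nu11%:M nu12%:M nu12%:M nu22%:M.

(* [normal_prob mu 0] is a junk value in the library (the uniform law on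
   [0, 1]), so the degenerate normal law N(mu, 0) is given separately. The
   second parameter of [gaussian_prob] is the variance; that of [normal_prob]
   is the standard deviation. *)
Definition gaussian_prob (R : realType) (mu nu : R) :
    probability (measurableTypeR R) R :=
  if nu == 0 then (@dirac _ (measurableTypeR R) mu R : probability _ R)
  else normal_prob mu (Num.sqrt nu).

(* Entries of the lower triangular Cholesky factor [[l11, 0], [l21, l22]] of
   [covmx2 nu11 nu22 nu12], see [cholP]. If nu11 = 0 then l21 = 0, because
   0^-1 = 0; this is the right value, as nu12 = 0 in that case. *)
Definition chol11 (R : realType) (nu11 : R) : R := Num.sqrt nu11.

Definition chol21 (R : realType) (nu11 nu12 : R) : R := nu12 / chol11 nu11.

Definition chol22 (R : realType) (nu11 nu22 nu12 : R) : R :=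
  Num.sqrt (nu22 - chol21 nu11 nu12 ^+ 2).

Lemma covmx2_quad (R : realType) (nu11 nu22 nu12 a b : R) :
  psdmx (covmx2 nu11 nu22 nu12) ->
  0 <= a ^+ 2 * nu11 + 2 * (a * b * nu12) + b ^+ 2 * nu22.
Proof.
move=> [_ /(_ (col_mx a%:M b%:M))].
rewrite /covmx2 tr_col_mx mul_row_block mul_row_col !tr_scalar_mx.
rewrite -!scalar_mxM -!raddfD -!scalar_mxM -raddfD mxE eqxx mulr1n.
by congr (0 <= _); ring.
Qed.

Lemma cholP (R : realType) (nu11 nu22 nu12 : R) :
  psdmx (covmx2 nu11 nu22 nu12) ->
  [/\ chol11 nu11 ^+ 2 = nu11,
      chol21 nu11 nu12 * chol11 nu11 = nu12 &
      chol21 nu11 nu12 ^+ 2 + chol22 nu11 nu22 nu12 ^+ 2 = nu22].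
Proof.
move=> psd; have Q a b := @covmx2_quad R nu11 nu22 nu12 a b psd.
have n11 : 0 <= nu11 by have := Q 1 0; rewrite expr1n expr0n/=; lra.
have n22 : 0 <= nu22 by have := Q 0 1; rewrite expr1n expr0n/=; lra.
rewrite /chol22 /chol21 /chol11.
have [n11E|n11_neq0] := eqVneq nu11 0.
  have n12E : nu12 = 0.
    apply/eqP/negPn/negP => n12.
    have := Q (- (nu22 + 1) / (2 * nu12)) 1; rewrite n11E mulr0 add0r.
    rewrite expr1n !mulr1 mul1r.
    have -> : 2 * (- (nu22 + 1) / (2 * nu12) * nu12) = - (nu22 + 1) by field.
    lra.
  by rewrite n11E n12E sqrtr0 !mul0r expr0n/= subr0 add0r sqr_sqrtr.
have s0 : Num.sqrt nu11 != 0 by rewrite sqrtr_eq0 -ltNge lt_neqAle eq_sym n11_neq0.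
have sq : Num.sqrt nu11 ^+ 2 = nu11 by rewrite sqr_sqrtr.
split => //; first by rewrite divfK.
rewrite expr_div_n sq sqr_sqrtr; first by ring.
have := Q (- nu12 / nu11) 1.
have -> : (- nu12 / nu11) ^+ 2 * nu11 + 2 * (- nu12 / nu11 * 1 * nu12)
    + 1 ^+ 2 * nu22 = nu22 - nu12 ^+ 2 / nu11 by field.
by [].
Qed.

Section binormal.
Context {R : realType}.
Variables mu1 mu2 nu11 nu22 nu12 : R.

Definition binormal_map (z : measurableTypeR R * measurableTypeR R) :
    measurableTypeR R * measurableTypeR R :=
  (mu1 + chol11 nu11 * z.1,
   mu2 + chol21 nu11 nu12 * z.1 + chol22 nu11 nu22 nu12 * z.2).

Lemma measurable_binormal_map : measurable_fun setT binormal_map.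
Proof.
apply/measurable_fun_pairP; split => /=.
- apply: measurable_funD; first exact: measurable_cst.
  by apply: measurable_funM; [exact: measurable_cst|exact: measurable_fst].
- apply: measurable_funD.
    apply: measurable_funD; first exact: measurable_cst.
    by apply: measurable_funM; [exact: measurable_cst|exact: measurable_fst].
  by apply: measurable_funM; [exact: measurable_cst|exact: measurable_snd].
Qed.

HB.instance Definition _ :=
  isMeasurableFun.Build _ _ _ _ binormal_map measurable_binormal_map.

(* The bivariate normal law with means mu1, mu2 and covariance matrix
   [covmx2 nu11 nu22 nu12]: the law of mu + L Z, with L the Cholesky factor
   and Z a pair of independent standard normal variables. It is meaningful for
   every positive semidefinite covariance matrix, singular ones included. *)
Definition binormal_prob :
    probability (measurableTypeR R * measurableTypeR R)%type R :=
  distribution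
    ((normal_prob (0 : R) 1 \x normal_prob (0 : R) 1)%E :
      probability (measurableTypeR R * measurableTypeR R)%type R)
    binormal_map.

End binormal.

Definition Phi (R : realType) (x : R) : R :=
  fine (normal_prob 0 1 `]-oo, x]).

Definition Phi2 (R : realType) (h k rho : R) : R :=
  fine (binormal_prob 0 0 1 1 rho [set z | z.1 <= h /\ z.2 <= k]).

Definition phi2 (R : realType) (h k rho : R) : R :=
  derive1 (fun x => derive1 (fun y => Phi2 x y rho) k) h.

Definition Phi21 (R : realType) (h k rho : R) : R :=
  derive1 (fun x => Phi2 x k rho) h.

(* M_sigma and K_sigma take values in the extended reals, so that an identity
   between finite values of them cannot hide a lack of integrability. *)
Definition Mact (R : realType) (sigma : R -> R) (mu nu : R) : \bar R :=
  'E_(gaussian_prob mu nu)[sigma].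

Definition Kact (R : realType) (sigma : R -> R)
    (mu1 mu2 nu11 nu22 nu12 : R) : \bar R :=
  covariance (binormal_prob mu1 mu2 nu11 nu22 nu12)
    (fun x => sigma x.1) (fun x => sigma x.2).

Definition gelu (R : realType) (x : R) : R := x * Phi x.

(* Main.v *)
(** All expectations reduce to integrals against the standard normal law [N] of
   one variable. Completing the square, with [B = sqrt (1 + b^2)],
     phi (a + b z) phi z = phi (a / B) / B * p z,
   where [p] is the density of the normal law of mean [- a b / B^2] and variance
   [B^-2], so integrating [phi (a + b Z) f Z] amounts to an affine change of
   variables; writing [Phi (a + b Z)] as an integral of [phi] and exchanging the integrals
   gives E [Phi (a + b Z) Phi (c + d Z)] = Phi2 (a / B) (c / D) (b d / (B D)).
   The left-hand side is symmetric in the two factors, which makes [Phi2]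
   symmetric and gives both orders of differentiation of [Phi2].

   In the Cholesky representation, integrating out the second coordinate turns
   gelu (X2) into [g (V Phi V) + (g^2 - 1) / g * phi V], with [V] affine in the
   first coordinate and [g^2 = 1 + l22^2]. What remains are moments
   E [Z^k F (Z)], with [F] a product of [Phi]'s and [phi]'s of affine functions,
   which Stein's identity E [Z f (Z)] = E [f' (Z)] lowers to [k = 0]. Singular
   covariance matrices need no separate treatment. *)
Require Import Defs.
From HB Require Import structures.
From mathcomp Require Import all_boot all_order all_algebra.
From mathcomp Require Import all_classical all_reals all_analysis.
From mathcomp Require Import measurable_realfun.
From mathcomp Require Import ring lra.

Set Implicit Arguments.
Unset Strict Implicit.
Unset Printing Implicit Defensive.

Import Order.TTheory GRing.Theory Num.Theory.
Import numFieldNormedType.Exports.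

Local Open Scope classical_set_scope.
Local Open Scope ring_scope.

(** * Integration against a normal law: densities and affine changes of variables *)

Section normal_law.
Context {R : realType}.
Local Notation leb := (@lebesgue_measure R).
Implicit Types (m s a b : R) (f g : R -> \bar R).

(** The Radon-Nikodym derivative of the law with respect to Lebesgue measure equals [normal_pdf]
    almost everywhere, since both have the same integral over every measurable set. *)
Lemma ge0_integral_normal_prob m s f :
  (forall x, 0 <= f x)%E -> measurable_fun setT f ->
  (\int[normal_prob m s]_x f x = \int[leb]_x (f x * (normal_pdf m s x)%:E))%E.
Proof.
move=> f0 mf.
have dom := normal_prob_dominates m s.
rewrite -(Radon_Nikodym_SigmaFinite.change_of_variables dom f0)//.
have mpdf : measurable_fun setT (EFin \o normal_pdf m s).
  by apply/measurable_EFinP; exact: measurable_normal_pdf.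
apply: ae_eq_integral => //.
- apply: emeasurable_funM => //.
  exact: measurable_int (Radon_Nikodym_SigmaFinite.f_integrable dom).
- exact: emeasurable_funM.
- apply: ae_eqe_mul2l; apply: integral_ae_eq => //.
  + exact: Radon_Nikodym_SigmaFinite.f_integrable.
  + by move=> E _ mE; rewrite -Radon_Nikodym_SigmaFinite.f_integral.
Qed.

Definition affine m s (x : measurableTypeR R) : measurableTypeR R := m + s * x.

Lemma measurable_affine m s : measurable_fun setT (affine m s).
Proof.
apply: measurable_funD; first exact: measurable_cst.
by apply: measurable_funM; [exact: measurable_cst|exact: measurable_id].
Qed.

HB.instance Definition _ m s :=
  isMeasurableFun.Build _ _ _ _ (affine m s) (measurable_affine m s).

(** The right-hand side is a scaled image measure in [A]. It agrees with Lebesgue measure on the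
    intervals []a, b]], hence everywhere by uniqueness. *)
Lemma lebesgue_measure_affine m s (s0 : 0 < s) (A : set R) : measurable A ->
  leb A = (s%:E * leb (affine m s @^-1` A))%E.
Proof.
move=> mA.
have s0' : 0 <= s by exact: ltW.
pose mu' : {measure set (measurableTypeR R) -> \bar R} :=
  mscale (NngNum s0') (pushforward leb (affine m s)).
pose mu := mu' (measurable_affine m s).
have -> : (s%:E * leb (affine m s @^-1` A))%E = mu A by [].
apply: lebesgue_measure_unique => // X [[a b] _ <-].
have E : affine m s @^-1` [set` `]a, b]%R] =
    [set` `](a - m) / s, (b - m) / s]%R].
  apply/seteqP; split => x /=; rewrite !in_itv/= /affine.
    by rewrite ltr_pdivrMr// ler_pdivlMr// ltrBlDl lerBrDl (mulrC x).
  by rewrite ltr_pdivrMr// ler_pdivlMr// ltrBlDl lerBrDl (mulrC x).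
have -> : mu [set` `]a, b]%R] =
    (s%:E * leb [set` `](a - m) / s, (b - m) / s]%R])%E by rewrite -E.
rewrite /= !lebesgue_measure_itv/= !lte_fin ltr_pM2r ?invr_gt0// ltrBlDr subrK.
case: ifPn => _; last by rewrite mule0.
by rewrite -!EFinB -EFinM; congr (_%:E); field; rewrite gt_eqF.
Qed.

Lemma ge0_integral_affine m s (s0 : 0 < s) f :
  (forall x, 0 <= f x)%E -> measurable_fun setT f ->
  (\int[leb]_x f x = s%:E * \int[leb]_x f (m + s * x)%R)%E.
Proof.
move=> f0 mf.
have s0' : 0 <= s by exact: ltW.
pose mu' : {measure set (measurableTypeR R) -> \bar R} :=
  mscale (NngNum s0') (pushforward leb (affine m s)).
pose mu := mu' (measurable_affine m s).
transitivity (\int[mu]_x f x)%E.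
  apply: eq_measure_integral => A mA _.
  exact: (lebesgue_measure_affine m s0 mA).
rewrite ge0_integral_mscale//=; congr (_ * _)%E.
by rewrite (ge0_integral_pushforward (measurable_affine m s)).
Qed.

(** In density form, [x = m + s * z] turns [s * normal_pdf m s x] into the standard density at
    [z]. *)
Lemma ge0_integral_normal_affine m s (s0 : 0 < s) f :
  (forall x, 0 <= f x)%E -> measurable_fun setT f ->
  (\int[normal_prob m s]_x f x = \int[normal_prob 0 1]_x f (m + s * x)%R)%E.
Proof.
move=> f0 mf.
have mfa : measurable_fun setT (fun x => f (m + s * x)).
  exact: measurableT_comp mf (measurable_affine m s).
apply: etrans (ge0_integral_normal_prob m s f0 mf) _; apply/esym.
apply: etrans (ge0_integral_normal_prob 0 1 (fun x => f0 (m + s * x)) mfa) _.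
apply/esym.
rewrite (ge0_integral_affine m s0); first last.
- apply: emeasurable_funM => //.
  by apply/measurable_EFinP; exact: measurable_normal_pdf.
- by move=> x; rewrite mule_ge0// lee_fin normal_pdf_ge0.
rewrite -ge0_integralZl//; first last.
- by rewrite lee_fin ltW.
- by move=> x _; rewrite mule_ge0// lee_fin normal_pdf_ge0.
- apply: emeasurable_funM; first exact: mfa.
  apply/measurable_EFinP.
  exact: measurableT_comp (measurable_normal_pdf m s) (measurable_affine m s).
apply: eq_integral => x _; rewrite muleCA -EFinM; congr (_ * _%:E)%E.
rewrite !normal_pdfE ?gt_eqF//= /normal_peak /normal_fun.
have -> : s ^+ 2 * pi *+ 2 = s ^+ 2 * (1 ^+ 2 * pi *+ 2) by ring.
rewrite sqrtrM ?sqr_ge0// sqrtr_sqr gtr0_norm// invfM !mulrA divff ?gt_eqF//.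
rewrite mul1r.
by congr (_ * expR _); field; rewrite gt_eqF.
Qed.

Lemma normal_prob_affine m s (s0 : 0 < s) (A : set (measurableTypeR R)) :
  measurable A ->
  normal_prob m s A = normal_prob 0 1 (affine m s @^-1` A).
Proof.
move=> mA; have mA' : measurable (affine m s @^-1` A).
  by rewrite -[X in measurable X]setTI; exact: measurable_affine.
have intE (mu : {measure set (measurableTypeR R) -> \bar R}) B :
    measurable B -> mu B = (\int[mu]_x (\1_B x)%:E)%E.
  by move=> mB; rewrite integral_indic// setIT.
rewrite (intE _ _ mA) (intE _ _ mA').
rewrite (@ge0_integral_normal_affine _ _ s0 (EFin \o \1_A)) => //.
- by move=> x; rewrite lee_fin.
- by apply/measurable_EFinP; exact: measurable_indic.
Qed.

End normal_law.

(** * The standard normal density and distribution function *)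

Section standard_normal.
Context {R : realType}.
Local Notation leb := (@lebesgue_measure R).
Local Notation N := (normal_prob (0 : R) 1).
Local Notation phi := (normal_pdf (0 : R) 1).
Implicit Types (a b c d v x z : R).

Lemma std_pdfE x : phi x = normal_peak 1 * expR (- x ^+ 2 / 2).
Proof.
rewrite normal_pdfE ?oner_neq0//= /normal_fun subr0.
by congr (_ * expR (_ / _)); rewrite expr1n.
Qed.

Lemma continuous_std_pdf : continuous phi.
Proof. by apply: continuous_normal_pdf; exact: oner_neq0. Qed.

Lemma std_pdf_le x : phi x <= normal_peak 1.
Proof. by apply: normal_pdf_ub; exact: oner_neq0. Qed.

Lemma is_derive_std_pdf x : is_derive x 1 phi (- x * phi x).
Proof.
have -> : phi = (fun x => normal_peak 1 * expR (- x ^+ 2 / 2)).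
  by apply/funext => y; rewrite std_pdfE.
apply: is_derive_eq.
by rewrite /GRing.scale/=; field.
Qed.

Lemma PhiE x : (Phi x)%:E = N `]-oo, x].
Proof. by rewrite fineK// fin_num_measure. Qed.

Lemma Phi_ge0 x : 0 <= Phi x. Proof. exact: fine_ge0. Qed.

Lemma Phi_le1 x : Phi x <= 1.
Proof. by rewrite -lee_fin PhiE probability_le1. Qed.

Lemma is_derive_Phi x : is_derive x 1 (@Phi R) (phi x).
Proof.
(* By definition of the law, [Phi x] is the integral of [phi] up to [x]; [x + 1] is merely some
   point to the right of [x]. *)
have [||||dP P'] := @continuous_FTC1 R phi -oo%O x (x + 1).
- by rewrite ltrDl.
- by apply: integrableS (integrable_normal_pdf 0 1).
- exact: ltNyr.
- exact: continuous_std_pdf.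
- by rewrite -P' derive1E; exact: derivableP.
Qed.

Lemma continuous_Phi : continuous (@Phi R).
Proof.
move=> x; apply: differentiable_continuous; apply/derivable1_diffP.
by have [] := is_derive_Phi x.
Qed.

Lemma measurable_Phi : measurable_fun setT (@Phi R).
Proof. by apply: continuous_measurable_fun; exact: continuous_Phi. Qed.

Lemma measurable_Phi_affine m s :
  measurable_fun setT (fun z : R => Phi (m + s * z)).
Proof. exact: measurableT_comp measurable_Phi (measurable_affine m s). Qed.

Lemma measurable_std_pdf_affine m s :
  measurable_fun setT (fun z => phi (m + s * z)).
Proof.
exact: measurableT_comp (measurable_normal_pdf 0 1) (measurable_affine m s).
Qed.

(** * Completing the square, with [B] standing for the square root of [1 + b ^+ 2] *)

Section completing_the_square.
Variables b B : R.
Hypotheses (B0 : 0 < B) (B2 : B ^+ 2 = 1 + b ^+ 2).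

Let normal_peakV : normal_peak B^-1 = B * normal_peak 1.
Proof.
rewrite /normal_peak.
have -> : B^-1 ^+ 2 * pi *+ 2 = B^-1 ^+ 2 * (1 ^+ 2 * pi *+ 2) by ring.
by rewrite sqrtrM ?sqr_ge0// sqrtr_sqr gtr0_norm ?invr_gt0// invfM invrK.
Qed.

(** As a function of [v], [B * phi (B * v + b * z)] is thus a probability density, whose mass on
    [v <= a / B] is [Phi (a + b * z)]. *)
Lemma normal_pdf_shift v z :
  normal_pdf (- b * z / B) B^-1 v = B * phi (B * v + b * z).
Proof.
have B_neq0 : B != 0 by rewrite gt_eqF.
rewrite std_pdfE normal_pdfE ?invr_eq0//= normal_peakV /normal_fun [RHS]mulrA.
by congr (_ * expR _); field.
Qed.

(** The exponents agree because [(B v + b z)^2 + z^2 = v^2 + (B z + b v)^2] when [B^2 = 1 + b^2]. *)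
Lemma std_pdfM v z :
  phi (B * v + b * z) * phi z =
  phi v / B * normal_pdf (- b * v / B) B^-1 z.
Proof.
have B_neq0 : B != 0 by rewrite gt_eqF.
rewrite !std_pdfE normal_pdfE ?invr_eq0//= normal_peakV /normal_fun.
have -> : normal_peak 1 * expR (- v ^+ 2 / 2) / B *
    (B * normal_peak 1 * expR (- (z - - b * v / B) ^+ 2 / (B^-1 ^+ 2 *+ 2))) =
    normal_peak 1 * normal_peak 1 * (expR (- v ^+ 2 / 2) *
      expR (- (z - - b * v / B) ^+ 2 / (B^-1 ^+ 2 *+ 2))) :> R.
  by field.
rewrite mulrACA -!expRD; congr (_ * expR _).
have -> : - (z - - b * v / B) ^+ 2 / (B^-1 ^+ 2 *+ 2) =
  - (B * z + b * v) ^+ 2 / 2 by field.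
have -> : - (B * z + b * v) ^+ 2 / 2 =
  - (B ^+ 2 * z ^+ 2 + 2 * B * z * b * v + b ^+ 2 * v ^+ 2) / 2 by field.
have -> : - (B * v + b * z) ^+ 2 / 2 =
  - (B ^+ 2 * v ^+ 2 + 2 * B * z * b * v + b ^+ 2 * z ^+ 2) / 2 by field.
by rewrite B2; field.
Qed.

Lemma integral_std_pdf_affine v (g : R -> \bar R) :
  (forall x, 0 <= g x)%E -> measurable_fun setT g ->
  (\int[N]_z ((phi (B * v + b * z)%R)%:E * g z) =
   (phi v / B)%R%:E * \int[N]_w g (- b * v / B + B^-1 * w)%R)%E.
Proof.
move=> g0 mg.
have h0 z : (0 <= (phi (B * v + b * z)%R)%:E * g z)%E.
  by rewrite mule_ge0// lee_fin normal_pdf_ge0.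
have mh : measurable_fun setT (fun z => (phi (B * v + b * z)%R)%:E * g z)%E.
  apply: emeasurable_funM => //; apply/measurable_EFinP.
  exact: measurable_std_pdf_affine.
apply: etrans (ge0_integral_normal_prob 0 1 h0 mh) _.
have Bv0 : 0 < B^-1 by rewrite invr_gt0.
transitivity ((phi v / B)%R%:E * \int[normal_prob (- b * v / B)%R B^-1%R]_z g z)%E;
    last first.
  by rewrite (ge0_integral_normal_affine (- b * v / B) Bv0 g0 mg).
transitivity ((phi v / B)%R%:E *
    \int[leb]_z (g z * (normal_pdf (- b * v / B)%R B^-1%R z)%:E))%E; last first.
  by rewrite (ge0_integral_normal_prob (- b * v / B) B^-1 g0 mg).
rewrite -ge0_integralZl//; first last.
- by rewrite lee_fin divr_ge0 ?normal_pdf_ge0// ltW.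
- by move=> x _; rewrite mule_ge0// lee_fin normal_pdf_ge0.
- apply: emeasurable_funM => //; apply/measurable_EFinP.
  exact: measurable_normal_pdf.
apply: eq_integral => z _.
by rewrite muleAC -EFinM std_pdfM EFinM -muleA (muleC _ (g z)).
Qed.

(** [Phi (a + b * z)] is written as an integral over [v <= a / B], a domain independent of [z].
    Tonelli's theorem exchanges the integrals, and [integral_std_pdf_affine] computes the one in
    [z]. *)
Lemma integral_Phi_affine a (g : R -> \bar R) :
  (forall x, 0 <= g x)%E -> measurable_fun setT g ->
  (\int[N]_z ((Phi (a + b * z)%R)%:E * g z) =
   \int[leb]_(v in [set` `]-oo, a / B]%R])
     ((phi v)%:E * \int[N]_w g (- b * v / B + B^-1 * w)%R))%E.
Proof.
move=> g0 mg.
have Bv0 : 0 < B^-1 by rewrite invr_gt0.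
have PhiE' z : (Phi (a + b * z)%R)%:E =
    (\int[leb]_(v in [set` `]-oo, a / B]%R]) (B * phi (B * v + b * z))%R%:E)%E.
  have -> : (Phi (a + b * z)%R)%:E = normal_prob (- b * z / B) B^-1 `]-oo, a / B].
    rewrite (normal_prob_affine (- b * z / B) Bv0)// PhiE; congr (N _).
    have xE x : (- b * z / B + B^-1 * x <= a / B) = (x <= a + b * z).
      rewrite (_ : _ + _ = (x - b * z) / B); last by field; rewrite gt_eqF.
      by rewrite ler_pM2r// lerBlDr.
    by apply/seteqP; split => x /=; rewrite !in_itv/= /affine xE.
  by rewrite /normal_prob; apply: eq_integral => v _; rewrite normal_pdf_shift.
pose D := [set` `]-oo, a / B]%R] : set (measurableTypeR R).
have mD : measurable D by exact: measurable_itv.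
(* The indicator of [D] moves the domain of [v] into the integrand, so that Tonelli's theorem
   applies on the whole product. *)
pose h (zv : measurableTypeR R * measurableTypeR R) : \bar R :=
  ((B * phi (B * zv.2 + b * zv.1) * \1_D zv.2)%R%:E * g zv.1)%E.
have h0 zv : (0 <= h zv)%E.
  by rewrite mule_ge0// lee_fin mulr_ge0// mulr_ge0 ?normal_pdf_ge0// ltW.
have mlin : measurable_fun setT
    (fun zv : measurableTypeR R * measurableTypeR R => B * zv.2 + b * zv.1).
  apply: measurable_funD.
    by apply: measurable_funM; [exact: measurable_cst|exact: measurable_snd].
  by apply: measurable_funM; [exact: measurable_cst|exact: measurable_fst].
have mh : measurable_fun setT h.
  apply: emeasurable_funM.
    apply/measurable_EFinP; apply: measurable_funM.
      apply: measurable_funM; first exact: measurable_cst.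
      exact: measurableT_comp (measurable_normal_pdf 0 1) mlin.
    exact: measurableT_comp (measurable_indic mD) measurable_snd.
  exact: measurableT_comp mg measurable_fst.
transitivity (\int[N]_z \int[leb]_v h (z, v))%E.
  apply: eq_integral => z _; rewrite PhiE' integral_mkcond/=.
  rewrite -ge0_integralZr//; first last.
  - move=> v _; rewrite /patch; case: ifPn => // _.
    by rewrite lee_fin mulr_ge0 ?normal_pdf_ge0// ltW.
  - apply/(measurable_restrictT _ _).1 => //; apply: measurable_funTS.
    apply/measurable_EFinP; apply: measurable_funM => //.
    by under eq_fun do rewrite addrC; exact: measurable_std_pdf_affine.
  apply: eq_integral => v _; rewrite /h/= patchE indicE; case: ifPn => vD.
    by rewrite mulr1.
  by rewrite mulr0.
have swap := @fubini_tonelli _ _ _ _ R N leb h mh h0.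
apply: etrans swap _; rewrite [RHS]integral_mkcond.
apply: eq_integral => v _; rewrite patchE; case: ifPn => vD; last first.
  apply: integral0_eq => z _; rewrite /h/= indicE (negbTE vD).
  by rewrite mulr0 mul0e.
transitivity (B%:E * \int[N]_z ((phi (B * v + b * z)%R)%:E * g z))%E.
  rewrite -ge0_integralZl//; first last.
  - by rewrite lee_fin ltW.
  - by move=> z _; rewrite mule_ge0// lee_fin normal_pdf_ge0.
  - apply: emeasurable_funM => //; apply/measurable_EFinP.
    exact: measurable_std_pdf_affine.
  by apply: eq_integral => z _; rewrite /h/= indicE vD mulr1 EFinM muleA.
rewrite integral_std_pdf_affine// muleA -EFinM; congr (_%:E * _)%E.
by field; rewrite gt_eqF.
Qed.

End completing_the_square.

End standard_normal.

(** * The bivariate normal distribution function, its derivatives, and expectations of products *)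

Section bivariate.
Context {R : realType}.
Local Notation leb := (@lebesgue_measure R).
Local Notation N := (normal_prob (0 : R) 1).
Local Notation phi := (normal_pdf (0 : R) 1).
Local Notation rt b := (Num.sqrt (1 + b ^+ 2)).
Implicit Types (a b c d h k rho v x z : R).

Lemma rt_gt0 b : 0 < rt b.
Proof. by rewrite sqrtr_gt0 ltr_pwDl// sqr_ge0. Qed.

Lemma sqr_rt b : rt b ^+ 2 = 1 + b ^+ 2.
Proof. by rewrite sqr_sqrtr// addr_ge0// sqr_ge0. Qed.

Lemma continuous_affine m s : continuous (fun z : R => m + s * z).
Proof.
move=> x; apply: cvgD; first exact: cvg_cst.
by apply: cvgM; [exact: cvg_cst|exact: cvg_id].
Qed.

Lemma continuous_Phi_affine m s : continuous (fun z : R => Phi (m + s * z)).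
Proof.
move=> x; apply: (@continuous_comp _ _ _ (fun z => m + s * z) (@Phi R)).
  exact: continuous_affine.
exact: continuous_Phi.
Qed.

Lemma continuous_std_pdf_affine m s : continuous (fun z : R => phi (m + s * z)).
Proof.
move=> x; apply: (@continuous_comp _ _ _ (fun z => m + s * z) phi).
  exact: continuous_affine.
exact: continuous_std_pdf.
Qed.

Let integral1 : (\int[N]_z (1 : \bar R) = 1)%E.
Proof.
apply: etrans (@integral_cst _ _ _ N _ measurableT 1%E) _.
by rewrite mul1e; exact: probability_setT.
Qed.

Lemma integral_Phi a b :
  (\int[N]_z (Phi (a + b * z)%R)%:E = (Phi (a / rt b))%:E)%E.
Proof.
have /= H := @integral_Phi_affine R b (rt b) (rt_gt0 b) (sqr_rt b) a (cst 1%E)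
  (fun=> lee01) (measurable_cst _).
have -> : (\int[N]_z (Phi (a + b * z)%R)%:E =
    \int[N]_z ((Phi (a + b * z)%R)%:E * 1))%E.
  by apply: eq_integral => z _; rewrite mule1.
rewrite H PhiE /normal_prob; apply: eq_integral => v _.
by rewrite integral1 mule1.
Qed.

Lemma integral_std_pdf a b :
  (\int[N]_z (phi (a + b * z)%R)%:E = (phi (a / rt b) / rt b)%:E)%E.
Proof.
have /= H := @integral_std_pdf_affine R b (rt b) (rt_gt0 b) (sqr_rt b) (a / rt b)
  (cst 1%E) (fun=> lee01) (measurable_cst _).
have -> : (\int[N]_z (phi (a + b * z)%R)%:E =
    \int[N]_z ((phi (rt b * (a / rt b) + b * z)%R)%:E * 1))%E.
  apply: eq_integral => z _.
  by rewrite mule1 (mulrC (rt b)) divfK// gt_eqF// rt_gt0.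
by rewrite H integral1 mule1.
Qed.

(** The Cholesky factor of the correlation matrix has rows [(1, 0)] and [(rho, s)], with [s] the
    square root of [1 - rho ^+ 2]. Given the first coordinate [v], the second is [rho * v + s * Y],
    at most [k] exactly when [Y <= (k - rho * v) / s]. *)
Lemma Phi2E h k rho : rho ^+ 2 < 1 ->
  (Phi2 h k rho)%:E = (\int[leb]_(v in [set` `]-oo, h]%R])
    (phi v * Phi ((k - rho * v) / Num.sqrt (1 - rho ^+ 2))%R)%R%:E)%E.
Proof.
move=> rho1; set s := Num.sqrt _.
have s0 : 0 < s by rewrite sqrtr_gt0 subr_gt0.
set S := [set z : measurableTypeR R * measurableTypeR R | z.1 <= h /\ z.2 <= k].
have mS : measurable S.
  have -> : S = [set` `]-oo, h]%R] `*` [set` `]-oo, k]%R].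
    by apply/seteqP; split => -[x y] /=; rewrite !in_itv/=.
  exact: measurableX.
rewrite /Phi2 fineK ?fin_num_measure//.
pose f := @binormal_map R 0 0 1 1 rho.
have -> : binormal_prob 0 0 1 1 rho S = (\int[N]_x N (xsection (f @^-1` S) x))%E.
  by [].
have fE x y : f (x, y) = (x, rho * x + s * y).
  by rewrite /f /binormal_map /chol22 /chol21 /chol11/= sqrtr1 divr1 mul1r !add0r.
have SE x : xsection (f @^-1` S) x = [set y | x <= h /\ rho * x + s * y <= k].
  apply/seteqP; split => y;
    by rewrite /xsection /mkset in_setE /preimage /S /mkset fE.
pose D := [set` `]-oo, h]%R] : set (measurableTypeR R).
have mD : measurable D by exact: measurable_itv.
pose g x := \1_D x * Phi (k / s + (- rho / s) * x).
have gE x : N (xsection (f @^-1` S) x) = (g x)%:E.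
  rewrite /g indicE; case: (boolP (x \in D)) => xD; last first.
    rewrite mul0r SE (_ : [set _ | _] = set0) ?measure0//.
    apply/seteqP; split => y //= -[xh _].
    by move: xD; rewrite notin_setE /D /=; apply; rewrite in_itv.
  rewrite mul1r PhiE; congr (N _); move: xD; rewrite inE /D /= in_itv/= => xh.
  have yE y : (y <= k / s + - rho / s * x) = (rho * x + s * y <= k).
    have -> : k / s + - rho / s * x = (k - rho * x) / s by field; rewrite gt_eqF.
    by rewrite ler_pdivlMr// lerBrDl (mulrC y).
  by rewrite SE; apply/seteqP; split => y /=; rewrite in_itv/= yE => // -[].
have g0 x : (0 <= (g x)%:E)%E by rewrite lee_fin mulr_ge0// Phi_ge0.
have mg : measurable_fun setT (EFin \o g).
  apply/measurable_EFinP; apply: measurable_funM; first exact: measurable_indic.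
  exact: measurable_Phi_affine.
transitivity (\int[N]_x (g x)%:E)%E.
  by apply: eq_integral => x _; exact: gE.
rewrite (ge0_integral_normal_prob 0 1 g0 mg) [RHS]integral_mkcond.
apply: eq_integral => x _; rewrite patchE /g indicE; case: ifPn => _; last first.
  by rewrite mul0r mul0e.
by rewrite mul1r -EFinM mulrC; congr (_ * Phi _)%:E; field; rewrite gt_eqF.
Qed.

(** Only the upper limit of the integral in [Phi2E] depends on [h], so the fundamental theorem of
    calculus returns the integrand at [h]. *)
Lemma Phi21E h k rho : rho ^+ 2 < 1 ->
  Phi21 h k rho = phi h * Phi ((k - rho * h) / Num.sqrt (1 - rho ^+ 2)).
Proof.
move=> rho1; pose s : R := Num.sqrt (1 - rho ^+ 2).
have s0 : 0 < s by rewrite sqrtr_gt0 subr_gt0.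
pose f v := phi v * Phi ((k - rho * v) / s).
have fE : f = (fun v => phi v * Phi (k / s + (- rho / s) * v)).
  by apply/funext => v; congr (_ * Phi _); field; rewrite gt_eqF.
have -> : Phi21 h k rho =
    derive1 (fun x => (\int[leb]_(t in [set` `]-oo, x]]) f t)%R) h.
  congr (derive1 _ h); apply/funext => x.
  by rewrite -[LHS]/(fine (Phi2 x k rho)%:E) Phi2E.
have [||||_ ->//] := @continuous_FTC1 R f -oo%O h (h + 1).
- by rewrite ltrDl.
- apply: integrableS (_ : leb.-integrable setT _) => //.
  apply: le_integrable (integrable_normal_pdf 0 1) => //.
    apply/measurable_EFinP; rewrite fE; apply: measurable_funM.
      exact: measurable_normal_pdf.
    exact: measurable_Phi_affine.
  move=> x _ /=; rewrite lee_fin normrM ger0_norm ?normal_pdf_ge0//.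
  by rewrite ler_piMr ?normal_pdf_ge0// ger0_norm ?Phi_ge0// Phi_le1.
- exact: ltNyr.
- rewrite fE; apply: cvgM; first exact: continuous_std_pdf.
  exact: continuous_Phi_affine.
Qed.

Section affine_pair.
Variables a b c d : R.
Let B := rt b.
Let D := rt d.
Let rho := b * d / (B * D).
Let s := Num.sqrt (1 - rho ^+ 2).
Let T := rt (d / B).

Let B0 : 0 < B. Proof. exact: rt_gt0. Qed.
Let D0 : 0 < D. Proof. exact: rt_gt0. Qed.
Let B2 : B ^+ 2 = 1 + b ^+ 2. Proof. exact: sqr_rt. Qed.
Let D2 : D ^+ 2 = 1 + d ^+ 2. Proof. exact: sqr_rt. Qed.

Lemma corr_lt1 : rho ^+ 2 < 1.
Proof.
rewrite /rho expr_div_n ltr_pdivrMr ?exprn_gt0 ?mulr_gt0// mul1r.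
rewrite !exprMn B2 D2.
have := sqr_ge0 b; have := sqr_ge0 d; nra.
Qed.

(** Both [1 - rho ^+ 2] and [(T / D) ^+ 2] equal [(1 + b^2 + d^2) / (B^2 D^2)]. *)
Lemma sqrt_corr : s = T / D.
Proof.
have T0 : 0 < T by exact: rt_gt0.
rewrite /s (_ : 1 - rho ^+ 2 = (T / D) ^+ 2).
  by rewrite sqrtr_sqr gtr0_norm// divr_gt0.
have T2 : T ^+ 2 = 1 + (d / B) ^+ 2 by exact: sqr_rt.
rewrite /rho !expr_div_n T2 expr_div_n !exprMn B2 D2.
have b1 : 1 + b ^+ 2 != 0 by rewrite -B2 gt_eqF// exprn_gt0.
have d1 : 1 + d ^+ 2 != 0 by rewrite -D2 gt_eqF// exprn_gt0.
by field; rewrite b1 d1.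
Qed.

(** The left side is what completing the square produces; the right side is the argument of [Phi] in
    [Phi2E] and [Phi21E]. *)
Lemma cond_mean v : (c - d * b * v / B) / T = (c / D - rho * v) / s.
Proof.
have T0 : T != 0 by rewrite gt_eqF// rt_gt0.
by rewrite sqrt_corr /rho; field; rewrite T0 !gt_eqF.
Qed.

(** For [W1], [W2] standard normal and independent of [Z] and of each other, this is the probability
    of [W1 - b Z <= a] and [W2 - d Z <= c]: the variances are [B^2] and [D^2], the covariance is
    [b d]. *)
Lemma integral_PhiPhi :
  (\int[N]_z (Phi (a + b * z) * Phi (c + d * z))%R%:E =
   (Phi2 (a / B) (c / D) rho)%:E)%E.
Proof.
under eq_integral do rewrite EFinM.
have g0 z : (0 <= (Phi (c + d * z)%R)%:E)%E by rewrite lee_fin Phi_ge0.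
have mg : measurable_fun setT (EFin \o (fun z => Phi (c + d * z))).
  by apply/measurable_EFinP; exact: measurable_Phi_affine.
rewrite (integral_Phi_affine B0 B2 a g0 mg) (Phi2E _ _ corr_lt1).
apply: eq_integral => v _; rewrite EFinM; congr (_ * _)%E.
have E z : Phi (c + d * (- b * v / B + B^-1 * z)) =
    Phi ((c - d * b * v / B) + (d / B) * z).
  by congr Phi; field; rewrite gt_eqF.
under eq_integral do rewrite E.
by rewrite integral_Phi cond_mean.
Qed.

Lemma integral_phiPhi :
  (\int[N]_z (phi (a + b * z) * Phi (c + d * z))%R%:E =
   (Phi21 (a / B) (c / D) rho / B)%:E)%E.
Proof.
have g0 z : (0 <= (Phi (c + d * z)%R)%:E)%E by rewrite lee_fin Phi_ge0.
have mg : measurable_fun setT (EFin \o (fun z => Phi (c + d * z))).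
  by apply/measurable_EFinP; exact: measurable_Phi_affine.
have E z : ((phi (a + b * z) * Phi (c + d * z))%R%:E =
    (phi (B * (a / B) + b * z)%R)%:E * (Phi (c + d * z)%R)%:E)%E.
  by rewrite EFinM (mulrC B) divfK ?gt_eqF.
under eq_integral do rewrite E.
rewrite (integral_std_pdf_affine B0 B2 (a / B) g0 mg) (Phi21E _ _ corr_lt1).
have E' z : Phi (c + d * (- b * (a / B) / B + B^-1 * z)) =
    Phi ((c - d * b * (a / B) / B) + (d / B) * z).
  by congr Phi; field; rewrite gt_eqF.
under eq_integral do rewrite E'.
by rewrite integral_Phi -/T cond_mean -EFinM mulrAC.
Qed.

End affine_pair.

(** Both sides are expectations of the same product of two [Phi]'s, taken in either order. The
    correlation is kept in the form in which [integral_PhiPhi] yields it. *)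
Lemma Phi2C h k b d :
  Phi2 h k (b * d / (rt b * rt d)) = Phi2 k h (b * d / (rt b * rt d)).
Proof.
apply: EFin_inj.
have E x y : x * rt y / rt y = x by rewrite mulfK// gt_eqF// rt_gt0.
have := integral_PhiPhi (k * rt d) d (h * rt b) b.
have := integral_PhiPhi (h * rt b) b (k * rt d) d.
rewrite !E (mulrC d) (mulrC (rt d)) => E1 E2.
apply: etrans (esym E1) _; apply: etrans E2.
by apply: eq_integral => z _; rewrite mulrC.
Qed.

(** In [phi2] the inner derivative is in the second argument. Symmetry makes it a [Phi21], known in
    closed form, which is then differentiated in [x]. *)
Lemma phi2E h k b d (rho := b * d / (rt b * rt d)) :
  phi2 h k rho = phi k * (phi ((h - rho * k) / Num.sqrt (1 - rho ^+ 2))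
    / Num.sqrt (1 - rho ^+ 2)).
Proof.
have rho1 : rho ^+ 2 < 1 by exact: corr_lt1.
set s := Num.sqrt _; have s0 : s != 0 by rewrite gt_eqF// sqrtr_gt0 subr_gt0.
rewrite /phi2.
have -> : (fun x => derive1 (fun y => Phi2 x y rho) k) =
    (fun x => phi k * Phi (s^-1 * x - rho * k / s)).
  apply/funext => x.
  have -> : (fun y => Phi2 x y rho) = (fun y => Phi2 y x rho).
    by apply/funext => y; exact: Phi2C.
  rewrite -/(Phi21 k x rho) Phi21E//; congr (_ * Phi _).
  by rewrite -/s; field.
rewrite derive1E; apply: derive_val.
have dPhi := is_derive_Phi (s^-1 * h - rho * k / s).
apply: is_derive_eq.
have -> : (h - rho * k) / s = s^-1 * h - rho * k / s by field.
by rewrite /GRing.scale/=; field.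
Qed.

Lemma integral_phiphi a b c d :
  (\int[N]_z (phi (a + b * z) * phi (c + d * z))%R%:E =
   (phi2 (a / rt b) (c / rt d) (b * d / (rt b * rt d)) / (rt b * rt d))%:E)%E.
Proof.
have g0 z : (0 <= (phi (a + b * z)%R)%:E)%E by rewrite lee_fin normal_pdf_ge0.
have mg : measurable_fun setT (EFin \o (fun z => phi (a + b * z))).
  by apply/measurable_EFinP; exact: measurable_std_pdf_affine.
have D0 := rt_gt0 d; have B0 := rt_gt0 b.
(* The square is completed on the second factor, to produce the factor [phi k] of [phi2E]. *)
have E z : ((phi (a + b * z) * phi (c + d * z))%R%:E =
    (phi (rt d * (c / rt d) + d * z)%R)%:E * (phi (a + b * z)%R)%:E)%E.
  by rewrite EFinM muleC (mulrC (rt d)) divfK ?gt_eqF.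
under eq_integral do rewrite E.
rewrite (integral_std_pdf_affine D0 (sqr_rt d) (c / rt d) g0 mg) phi2E.
have E' z : phi (a + b * (- d * (c / rt d) / rt d + (rt d)^-1 * z)) =
    phi ((a - b * d * (c / rt d) / rt d) + (b / rt d) * z).
  by congr (normal_pdf _ _ _); field; rewrite gt_eqF.
under eq_integral do rewrite E'.
rewrite integral_std_pdf cond_mean -EFinM (mulrC b d) (mulrC (rt b) (rt d)).
rewrite (sqrt_corr d b); congr EFin.
have T0 := rt_gt0 (b / rt d).
by field; rewrite !gt_eqF.
Qed.

End bivariate.

(** * Stein's identity for functions of quadratic growth *)

Section stein.
Context {R : realType}.
Local Notation leb := (@lebesgue_measure R).
Local Notation N := (normal_prob (0 : R) 1).
Local Notation phi := (normal_pdf (0 : R) 1).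
Implicit Types (f g df : R -> R) (K z : R).

Lemma integral_normal_prob m s f : measurable_fun setT f ->
  (\int[normal_prob m s]_x (f x)%:E =
   \int[leb]_x (f x * normal_pdf m s x)%:E)%E.
Proof.
move=> mf; have mEf : measurable_fun setT (EFin \o f) by exact/measurable_EFinP.
rewrite integralE [RHS]integralE; congr (_ - _)%E.
- rewrite (ge0_integral_normal_prob m s (funepos_ge0 _)
    (measurable_funepos mEf)).
  apply: eq_integral => x _; rewrite !funeposE -!EFin_max -EFinM.
  by rewrite maxr_pMl ?normal_pdf_ge0// mul0r.
- rewrite (ge0_integral_normal_prob m s (funeneg_ge0 _)
    (measurable_funeneg mEf)).
  apply: eq_integral => x _; rewrite !funenegE -!EFinN -!EFin_max -EFinM.
  by rewrite maxr_pMl ?normal_pdf_ge0// mul0r mulNr.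
Qed.

Definition quadratic f := exists K, forall z, `|f z| <= K * (1 + z ^+ 2).

Let sqrt2 : Num.sqrt 2 != 0 :> R. Proof. by rewrite gt_eqF// sqrtr_gt0. Qed.

(* Since 1 + z^2 <= 4 exp (z^2 / 4), [tail] dominates (1 + z^2) phi z; up to a
   constant it is the density of the normal law of variance 2. *)
Let tail z := 4 * normal_peak 1 * expR (- z ^+ 2 / 4) : R.

Let std_pdf_tail z : (1 + z ^+ 2) * phi z <= tail z.
Proof.
rewrite std_pdfE mulrCA /tail (mulrC 4) -!mulrA ler_wpM2l ?normal_peak_ge0//.
have -> : - z ^+ 2 / 4 = z ^+ 2 / 4 + (- z ^+ 2 / 2) :> R by field.
rewrite expRD mulrA ler_wpM2r ?expR_ge0//.
have := expR_ge1Dx (z ^+ 2 / 4); have := sqr_ge0 z; lra.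
Qed.

Let integrable_tail : leb.-integrable setT (EFin \o tail).
Proof.
have -> : EFin \o tail =
    (fun x => (4 * normal_peak 1 / normal_peak (Num.sqrt 2))%:E *
      (normal_pdf 0 (Num.sqrt 2) x)%:E)%E.
  apply/funext => z /=; rewrite -EFinM normal_pdfE//= /tail /normal_fun subr0.
  rewrite mulrA divfK ?gt_eqF ?normal_peak_gt0//; congr (_ * expR _)%:E.
  by rewrite sqr_sqrtr//; congr (_ / _); ring.
exact: integrableZl (integrable_normal_pdf 0 _).
Qed.

Let quadratic_tail f K : (forall z, `|f z| <= K * (1 + z ^+ 2)) ->
  forall z, `|f z * phi z| <= K * tail z.
Proof.
move=> fK z; have z0 := normal_pdf_ge0 0 1 z; rewrite normrM (ger0_norm z0).
apply: le_trans (_ : K * (1 + z ^+ 2) * phi z <= _); first by rewrite ler_wpM2r.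
rewrite -mulrA ler_wpM2l//.
have := fK 0; rewrite expr0n/= addr0 mulr1; exact: le_trans.
Qed.

Lemma quadratic_integrable_pdf f : measurable_fun setT f -> quadratic f ->
  leb.-integrable setT (fun x => (f x * phi x)%:E).
Proof.
move=> mf [K fK].
have iK := integrableZl measurableT K integrable_tail.
apply: le_integrable iK => //.
  apply/measurable_EFinP; apply: measurable_funM => //.
  exact: measurable_normal_pdf.
move=> z _ /=; rewrite lee_fin (le_trans (quadratic_tail fK z))//.
exact: ler_norm.
Qed.

Lemma quadratic_integrable f : measurable_fun setT f -> quadratic f ->
  N.-integrable setT (EFin \o f).
Proof.
move=> mf qf; apply/integrableP; split; first exact/measurable_EFinP.
have mnf : measurable_fun setT (fun x => `|f x|) by exact: measurableT_comp.
rewrite (_ : integral _ _ _ = (\int[N]_x (`|f x|)%:E)%E)//.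
rewrite (integral_normal_prob 0 1 mnf).
have /integrableP[_] := quadratic_integrable_pdf mf qf; apply: le_lt_trans.
rewrite le_eqVlt; apply/orP; left; apply/eqP; apply: eq_integral => x _ /=.
by rewrite normrM (ger0_norm (normal_pdf_ge0 0 1 x)).
Qed.

(** The derivative of [f z * phi z] is [h z = (df z - z * f z) * phi z]. Its integral over
    [[- M, M]] is a boundary term that vanishes as [M] grows, so the integral of [h] over the line
    is zero. *)
Lemma stein f df : (forall z, is_derive z 1 f (df z)) -> continuous df ->
  quadratic f -> quadratic df -> quadratic (fun z => z * f z) ->
  (\int[N]_z (z * f z)%R%:E = \int[N]_z (df z)%:E)%E.
Proof.
move=> dF cdf [K fK] qdf qzf.
have cf : continuous f.
  move=> x; apply: differentiable_continuous; apply/derivable1_diffP.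
  by have [] := dF x.
have czf : continuous (fun z => z * f z).
  by move=> x; apply: cvgM; [exact: cvg_id|exact: cf].
have mdf := continuous_measurable_fun cdf.
have mzf := continuous_measurable_fun czf.
pose h z := df z * phi z - z * f z * phi z.
have ch : continuous h.
  move=> x; apply: cvgB; apply: cvgM.
  - exact: cdf.
  - exact: continuous_std_pdf.
  - exact: czf.
  - exact: continuous_std_pdf.
pose G z := f z * phi z.
have dG z : is_derive z 1 G (h z).
  have := dF z; have := is_derive_std_pdf z => dphi df'.
  apply: is_derive_eq; rewrite /h /GRing.scale/=; ring.
have cG : continuous G.
  by move=> x; apply: cvgM; [exact: cf|exact: continuous_std_pdf].
have i1 := quadratic_integrable_pdf mdf qdf.
have i2 := quadratic_integrable_pdf mzf qzf.
have ih : leb.-integrable setT (EFin \o h).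
  exact: (integrableB measurableT i1 i2).
suff h0 : (\int[leb]_z (h z)%:E = 0)%E.
  rewrite (integral_normal_prob 0 1 mdf) (integral_normal_prob 0 1 mzf).
  have E := integralB_EFin measurableT i1 i2.
  have F1 := integrable_fin_num measurableT i1.
  have F2 := integrable_fin_num measurableT i2.
  have hE : (\int[leb]_z (h z)%:E =
      \int[leb]_z ((df z * phi z)%:E - (z * f z * phi z)%:E))%E by [].
  move: E; rewrite -hE h0 -(fineK F1) -(fineK F2) -EFinB => -[/esym/eqP].
  by rewrite subr_eq0 => /eqP ->.
(* Starting at 1 keeps the intervals nondegenerate and makes [harmonic n] the inverse of [M n]. *)
pose M n : R := n.+1%:R.
have M0 n : 0 < M n by rewrite ltr0n.
pose D n := [set` `[- M n, M n]%R] : set (measurableTypeR R).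
have mD n : measurable (D n) by exact: measurable_itv.
have FTC n : (\int[leb]_(z in D n) (h z)%:E = (G (M n) - G (- M n))%:E)%E.
  rewrite EFinB; apply: continuous_FTC2.
  - by rewrite gtrN.
  - exact: continuous_subspaceT.
  - split.
    + by move=> x _; have [] := dG x.
    + by apply: cvg_at_right_filter; exact: cG.
    + by apply: cvg_at_left_filter; exact: cG.
  - by move=> x _; rewrite derive1E; apply: derive_val; exact: dG.
(* [C] comes from [|G x| <= K * tail x] and the bound [exp (- M^2 / 4) <= 2 / M]. *)
pose C := 2 * K * 4 * normal_peak 1.
have G_le n x : `|x| = M n -> `|G x| <= C * harmonic n.
  move=> xM; apply: le_trans (quadratic_tail fK x) _.
  have K0 : 0 <= K.
    by have := fK 0; rewrite expr0n/= addr0 mulr1; exact: le_trans.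
  have -> : C * harmonic n =
      K * (4 * normal_peak 1 * (2 * harmonic n)) by rewrite /C; ring.
  rewrite /tail ler_wpM2l// ler_wpM2l ?mulr_ge0 ?normal_peak_ge0//.
  have -> : - x ^+ 2 / 4 = - (M n ^+ 2 / 4).
    by rewrite -xM real_normK ?num_real// mulNr.
  rewrite expRN /harmonic/= -/(M n) -[_^-1]mul1r ler_pdivrMr ?expR_gt0//.
  rewrite mulrAC ler_pdivlMr// mul1r.
  (* Here [exp (M^2 / 4) >= 1 + M^2 / 4 >= M], the last inequality being [(M - 2)^2 >= 0]. *)
  have := expR_ge1Dx (M n ^+ 2 / 4).
  have := sqr_ge0 (M n - 2); have := M0 n.
  have -> : (M n - 2) ^+ 2 = M n ^+ 2 - 4 * M n + 4 by ring.
  lra.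
have lim0 : (G (M n) - G (- M n))%:E @[n --> \oo] --> 0%E.
  apply: cvg_EFin; first exact: nearW.
  have lim_abs : `|G (M n) - G (- M n)| @[n --> \oo] --> (0 : R).
    apply: (@squeeze_cvgr _ _ _ _ (cst 0)
      (fun n => C * harmonic n + C * harmonic n)).
    - apply: nearW => n; rewrite normr_ge0/=.
      apply: le_trans (ler_normB _ _) _.
      have H1 := G_le n (M n) (gtr0_norm (M0 n)).
      have H2 : `|G (- M n)| <= C * harmonic n.
        by apply: G_le; rewrite normrN gtr0_norm.
      exact: lerD H1 H2.
    - exact: cvg_cst.
    - have cvgC : C * harmonic n @[n --> \oo] --> 0.
        rewrite -(mulr0 C); apply: cvgM; [exact: cvg_cst|exact: cvg_harmonic].
      by rewrite -(addr0 (0 : R)); exact: cvgD.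
  exact/norm_cvg0P.
pose h_ n z : \bar R := ((h \_ (D n)) z)%:E.
have mh : measurable_fun setT (EFin \o h).
  by apply/measurable_EFinP; exact: continuous_measurable_fun.
(* The truncations of [h] to [D n] are dominated by [|h|] and are eventually equal to [h] at each
   point. *)
have [|||||_ _] := @dominated_convergence _ _ _ leb _ measurableT h_
  (EFin \o h) (abse \o EFin \o h).
- move=> n; apply/measurable_EFinP/(measurable_restrictT _ _).1 => //.
  by apply: measurable_funTS; apply/measurable_EFinP.
- exact: mh.
- apply: aeW => x _; apply: cvg_near_cst; near=> n.
  rewrite /h_ patchE mem_set// /D /= in_itv/= -ler_norml.
  have xn : `|x| <= n%:R by near: n; exact: nbhs_infty_ger.
  by apply: le_trans xn _; rewrite /M ler_nat.
- exact: integrable_abse.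
- apply: aeW => x n _; rewrite /h_ /= lee_fin patchE; case: ifPn => //.
  by rewrite normr0.
have -> : (fun n => \int[leb]_x h_ n x)%E =
    (fun n => (G (M n) - G (- M n))%:E).
  apply/funext => n; rewrite -FTC [RHS]integral_mkcond.
  apply: eq_integral => x _.
  by rewrite /h_ restrict_EFin.
by move=> /cvg_lim <-//; exact/cvg_lim.
Unshelve. all: by end_near. Qed.

End stein.

(** * Moments of products of [Phi]'s and [phi]'s of affine functions *)

Section moments.
Context {R : realType}.
Local Notation leb := (@lebesgue_measure R).
Local Notation N := (normal_prob (0 : R) 1).
Local Notation phi := (normal_pdf (0 : R) 1).
Local Notation rt b := (Num.sqrt (1 + b ^+ 2)).
Implicit Types (f g : R -> R) (K z : R).

Definition bounded_continuous f :=
  continuous f /\ exists K, forall z, `|f z| <= K.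

(** A class on which expectations are finite and linear; it contains the products of a bounded
    continuous function with 1, [z] and [z^2]. *)
Definition tame f := continuous f /\ quadratic f.

Definition mean f : R := fine (\int[N]_z (f z)%:E)%E.

Lemma eq_mean f g : f =1 g -> mean f = mean g.
Proof. by move=> /funext ->. Qed.

Lemma mean_eq f x : (\int[N]_z (f z)%:E = x%:E)%E -> mean f = x.
Proof. by rewrite /mean => ->. Qed.

Lemma tame_integrable f : tame f -> N.-integrable setT (EFin \o f).
Proof.
move=> [cf qf]; apply: quadratic_integrable qf.
exact: continuous_measurable_fun.
Qed.

Lemma integral_tame f : tame f -> (\int[N]_z (f z)%:E = (mean f)%:E)%E.
Proof.
move=> tf; rewrite /mean fineK//.
exact: integrable_fin_num (tame_integrable tf).
Qed.

Lemma meanD f g : tame f -> tame g ->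
  mean (fun z => f z + g z) = mean f + mean g.
Proof.
move=> tf tg.
exact: RintegralD measurableT (tame_integrable tf) (tame_integrable tg).
Qed.

Lemma meanZ c f : tame f -> mean (fun z => c * f z) = c * mean f.
Proof. by move=> tf; exact: RintegralZl measurableT (tame_integrable tf). Qed.

Lemma tameD f g : tame f -> tame g -> tame (fun z => f z + g z).
Proof.
move=> [cf [K fK]] [cg [L gL]]; split.
  by move=> x; apply: cvgD; [exact: cf|exact: cg].
exists (K + L) => z; rewrite mulrDl (le_trans (ler_normD _ _))//.
by rewrite lerD.
Qed.

Lemma tameZ c f : tame f -> tame (fun z => c * f z).
Proof.
move=> [cf [K fK]]; split.
  by move=> x; apply: cvgM; [exact: cvg_cst|exact: cf].
by exists (`|c| * K) => z; rewrite normrM -mulrA ler_wpM2l.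
Qed.

Lemma bounded_continuousD f g : bounded_continuous f -> bounded_continuous g ->
  bounded_continuous (fun z => f z + g z).
Proof.
move=> [cf [K fK]] [cg [L gL]]; split.
  by move=> x; apply: cvgD; [exact: cf|exact: cg].
by exists (K + L) => z; rewrite (le_trans (ler_normD _ _))// lerD.
Qed.

Lemma bounded_continuousZ c f : bounded_continuous f ->
  bounded_continuous (fun z => c * f z).
Proof.
move=> [cf [K fK]]; split.
  by move=> x; apply: cvgM; [exact: cvg_cst|exact: cf].
by exists (`|c| * K) => z; rewrite normrM ler_wpM2l.
Qed.

Lemma bounded_continuousM f g : bounded_continuous f -> bounded_continuous g ->
  bounded_continuous (fun z => f z * g z).
Proof.
move=> [cf [K fK]] [cg [L gL]]; split.
  by move=> x; apply: cvgM; [exact: cf|exact: cg].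
by exists (K * L) => z; rewrite normrM ler_pM.
Qed.

Lemma bounded_tame f : bounded_continuous f -> tame f.
Proof.
move=> [cf [K fK]]; split => //; exists K => z; apply: le_trans (fK z) _.
have K0 : 0 <= K := le_trans (normr_ge0 _) (fK 0).
by rewrite ler_peMr// lerDl sqr_ge0.
Qed.

Let normr_le z : `|z| <= 1 + z ^+ 2.
Proof.
have := sqr_ge0 (`|z| - 1); have := normr_ge0 z.
rewrite -(real_normK (num_real z)).
have -> : (`|z| - 1) ^+ 2 = `|z| ^+ 2 - 2 * `|z| + 1 by ring.
by lra.
Qed.

Lemma bounded_tameX f : bounded_continuous f -> tame (fun z => z * f z).
Proof.
move=> [cf [K fK]]; split.
  by move=> x; apply: cvgM; [exact: cvg_id|exact: cf].
by exists K => z; rewrite normrM mulrC ler_pM.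
Qed.

Lemma bounded_tameX2 f : bounded_continuous f -> tame (fun z => z * (z * f z)).
Proof.
move=> [cf [K fK]]; split.
  by move=> x; apply: cvgM; [exact: cvg_id|apply: cvgM; [exact: cvg_id|exact: cf]].
exists K => z; rewrite mulrA normrM mulrC ler_pM// -expr2 ger0_norm ?sqr_ge0//.
by rewrite lerDr.
Qed.

Lemma mean_stein f df : (forall z, is_derive z 1 f (df z)) ->
  tame f -> tame df -> tame (fun z => z * f z) -> mean (fun z => z * f z) = mean df.
Proof. by move=> dF [_ qf] [cdf qdf] [_ qzf]; rewrite /mean (stein dF). Qed.

Lemma bounded_Phi a b : bounded_continuous (fun z => Phi (a + b * z)).
Proof.
split; first exact: continuous_Phi_affine.
by exists 1 => z; rewrite ger0_norm ?Phi_ge0 ?Phi_le1.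
Qed.

Lemma bounded_std_pdf a b : bounded_continuous (fun z => phi (a + b * z)).
Proof.
split; first exact: continuous_std_pdf_affine.
by exists (normal_peak 1) => z; rewrite ger0_norm ?normal_pdf_ge0 ?std_pdf_le.
Qed.

Lemma is_derive_affine a b z : is_derive z 1 (fun z : R => a + b * z) b.
Proof. by apply: is_derive_eq; rewrite /GRing.scale/=; ring. Qed.

Lemma is_derive_Phi_affine a b z :
  is_derive z 1 (fun z => Phi (a + b * z)) (b * phi (a + b * z)).
Proof.
have dA := is_derive_affine a b z; have dP := is_derive_Phi (a + b * z).
by rewrite mulrC; exact: is_derive1_comp.
Qed.

Lemma is_derive_std_pdf_affine a b z :
  is_derive z 1 (fun z => phi (a + b * z))
    (- b * ((a + b * z) * phi (a + b * z))).
Proof.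
have dA := is_derive_affine a b z; have dP := is_derive_std_pdf (a + b * z).
have -> : - b * ((a + b * z) * phi (a + b * z)) =
  - (a + b * z) * phi (a + b * z) * b by ring.
exact: is_derive1_comp.
Qed.

Section affine_pair.
Variables a b c d : R.
Let FF z := Phi (a + b * z) * Phi (c + d * z).
Let fF z := phi (a + b * z) * Phi (c + d * z).
Let Ff z := Phi (a + b * z) * phi (c + d * z).
Let ff z := phi (a + b * z) * phi (c + d * z).

Let bFF : bounded_continuous FF.
Proof. by apply: bounded_continuousM; exact: bounded_Phi. Qed.
Let bfF : bounded_continuous fF.
Proof.
by apply: bounded_continuousM; [exact: bounded_std_pdf|exact: bounded_Phi].
Qed.
Let bFf : bounded_continuous Ff.
Proof.
by apply: bounded_continuousM; [exact: bounded_Phi|exact: bounded_std_pdf].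
Qed.
Let bff : bounded_continuous ff.
Proof. by apply: bounded_continuousM; exact: bounded_std_pdf. Qed.

Let dFF z : is_derive z 1 FF (b * fF z + d * Ff z).
Proof.
have d1 := is_derive_Phi_affine a b z; have d2 := is_derive_Phi_affine c d z.
by apply: is_derive_eq; rewrite /GRing.scale/= /fF /Ff; ring.
Qed.

Let bdFF : bounded_continuous (fun z => b * fF z + d * Ff z).
Proof. by apply: bounded_continuousD; exact: bounded_continuousZ. Qed.

Lemma mean_XPhiPhi : mean (fun z => z * FF z) = b * mean fF + d * mean Ff.
Proof.
rewrite (mean_stein dFF (bounded_tame bFF) (bounded_tame bdFF)
  (bounded_tameX bFF)).
have t1 := bounded_tame bfF; have t2 := bounded_tame bFf.
by rewrite (meanD (tameZ _ t1) (tameZ _ t2)) (meanZ _ t1) (meanZ _ t2).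
Qed.

(** Differentiating [phi (a + b * z)] brings down [- b * (a + b * z)], so Stein's identity returns
    the same moment with coefficient [- b ^+ 2]; collecting it gives the factor [1 + b ^+ 2]. *)
Lemma mean_XphiPhi :
  (1 + b ^+ 2) * mean (fun z => z * fF z) = d * mean ff - a * b * mean fF.
Proof.
have dfF z : is_derive z 1 fF
    ((- b * a) * fF z + (- b ^+ 2 * (z * fF z) + d * ff z)).
  have d1 := is_derive_std_pdf_affine a b z.
  have d2 := is_derive_Phi_affine c d z.
  by apply: is_derive_eq; rewrite /GRing.scale/= /fF /ff; ring.
have t1 := bounded_tame bfF; have t2 := bounded_tame bff.
have t3 := bounded_tameX bfF.
have t4 : tame (fun z => - b ^+ 2 * (z * fF z) + d * ff z).
  by apply: tameD; exact: tameZ.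
have := mean_stein dfF t1 (tameD (tameZ _ t1) t4) t3.
rewrite (meanD (tameZ _ t1) t4) (meanD (tameZ _ t3) (tameZ _ t2)).
by rewrite (meanZ _ t1) (meanZ _ t2) (meanZ _ t3); lra.
Qed.

(** Stein's identity for [z * FF z], whose derivative contributes [FF] and first moments only. *)
Lemma mean_X2PhiPhi : mean (fun z => z * (z * FF z)) =
  mean FF + (b * mean (fun z => z * fF z) + d * mean (fun z => z * Ff z)).
Proof.
have dXFF z : is_derive z 1 (fun z => z * FF z)
    (FF z + (b * (z * fF z) + d * (z * Ff z))).
  have d1 := dFF z.
  by apply: is_derive_eq; rewrite /GRing.scale/=; ring.
have t1 := bounded_tameX bfF; have t2 := bounded_tameX bFf.
have t3 : tame (fun z => b * (z * fF z) + d * (z * Ff z)).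
  by apply: tameD; exact: tameZ.
rewrite (mean_stein dXFF (bounded_tameX bFF) (tameD (bounded_tame bFF) t3)
  (bounded_tameX2 bFF)).
rewrite (meanD (bounded_tame bFF) t3) (meanD (tameZ _ t1) (tameZ _ t2)).
by rewrite (meanZ _ t1) (meanZ _ t2).
Qed.

Lemma tame_UPhiVPhi :
  tame (fun z =>
    (a + b * z) * Phi (a + b * z) * ((c + d * z) * Phi (c + d * z))).
Proof.
have t0 := bounded_tame bFF; have t1 := bounded_tameX bFF.
have t2 := bounded_tameX2 bFF.
rewrite (_ : (fun z => _) = (fun z => a * c * FF z +
    ((a * d + b * c) * (z * FF z) + b * d * (z * (z * FF z))))).
  exact: tameD (tameZ _ t0) (tameD (tameZ _ t1) (tameZ _ t2)).
by apply/funext => z; rewrite /FF; ring.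
Qed.

Lemma tame_UPhiphi :
  tame (fun z => (a + b * z) * Phi (a + b * z) * phi (c + d * z)).
Proof.
have t0 := bounded_tame bFf; have t1 := bounded_tameX bFf.
rewrite (_ : (fun z => _) = (fun z => a * Ff z + b * (z * Ff z))).
  exact: tameD (tameZ _ t0) (tameZ _ t1).
by apply/funext => z; rewrite /Ff; ring.
Qed.

Lemma mean_UPhiVPhi :
  mean (fun z =>
    (a + b * z) * Phi (a + b * z) * ((c + d * z) * Phi (c + d * z))) =
  a * c * mean FF + ((a * d + b * c) * mean (fun z => z * FF z) +
    b * d * mean (fun z => z * (z * FF z))).
Proof.
have t0 := bounded_tame bFF; have t1 := bounded_tameX bFF.
have t2 := bounded_tameX2 bFF.
rewrite -(meanZ (a * c) t0) -(meanZ (a * d + b * c) t1) -(meanZ (b * d) t2).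
have t12 := tameD (tameZ (a * d + b * c) t1) (tameZ (b * d) t2).
rewrite -(meanD (tameZ _ t1) (tameZ _ t2)) -(meanD (tameZ _ t0) t12).
by apply: eq_mean => z; rewrite /FF; ring.
Qed.

Lemma mean_UPhiphi :
  mean (fun z => (a + b * z) * Phi (a + b * z) * phi (c + d * z)) =
  a * mean Ff + b * mean (fun z => z * Ff z).
Proof.
have t0 := bounded_tame bFf; have t1 := bounded_tameX bFf.
rewrite -(meanZ a t0) -(meanZ b t1) -(meanD (tameZ _ t0) (tameZ _ t1)).
by apply: eq_mean => z; rewrite /Ff; ring.
Qed.

End affine_pair.

Lemma tame_gelu_affine a b : tame (fun z => gelu (a + b * z)).
Proof.
have bF := bounded_Phi a b.
rewrite (_ : (fun z => _) =
    (fun z => a * Phi (a + b * z) + b * (z * Phi (a + b * z)))).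
  by apply: tameD; apply: tameZ; [exact: bounded_tame|exact: bounded_tameX].
by apply/funext => z; rewrite /gelu; ring.
Qed.

(** The closed form of the mean of GeLU under the normal law of mean [mu] and variance [nu]. *)
Definition gelu_mean mu nu : R :=
  mu * Phi (mu / Num.sqrt (1 + nu)) +
  nu * (phi (mu / Num.sqrt (1 + nu)) / Num.sqrt (1 + nu)).

Lemma mean_gelu a b : mean (fun z => gelu (a + b * z)) = gelu_mean a (b ^+ 2).
Proof.
have bF := bounded_Phi a b; have t0 := bounded_tame bF.
have t1 := bounded_tameX bF; have t2 := bounded_tame (bounded_std_pdf a b).
rewrite (_ : mean _ =
    mean (fun z => a * Phi (a + b * z) + b * (z * Phi (a + b * z)))).
  rewrite (meanD (tameZ _ t0) (tameZ _ t1)) (meanZ _ t0) (meanZ _ t1).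
  rewrite (mean_stein (is_derive_Phi_affine a b) t0 (tameZ _ t2) t1) (meanZ _ t2).
  rewrite (mean_eq (integral_Phi a b)) (mean_eq (integral_std_pdf a b)).
  by rewrite /gelu_mean; ring.
by apply: eq_mean => z; rewrite /gelu; ring.
Qed.

End moments.

(** * Expectations under the bivariate normal law, and the mean of GeLU *)

Section binormal_expectation.
Context {R : realType}.
Local Notation N := (normal_prob (0 : R) 1).
Local Notation phi := (normal_pdf (0 : R) 1).
Local Notation rt b := (Num.sqrt (1 + b ^+ 2)).
Local Notation T2 := (measurableTypeR R * measurableTypeR R)%type.
Implicit Types (F : T2 -> R) (x y : R).

Let tame_sq : tame (fun z : R => 1 + z ^+ 2).
Proof.
split; last by exists 1 => z; rewrite mul1r ger0_norm// addr_ge0// sqr_ge0.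
by move=> x; apply: cvgD; [exact: cvg_cst|exact: exprn_continuous].
Qed.

(** The dominating function is a product of functions of one variable with finite means, so its
    iterated integral is finite. *)
Lemma integrable_normal_prod (F : T2 -> R) C : measurable_fun setT F ->
  (forall x y, `|F (x, y)| <= C * (1 + x ^+ 2) * (1 + y ^+ 2)) ->
  (N \x N)%E.-integrable setT (EFin \o F).
Proof.
move=> mF FC; pose q := fun z : R => 1 + z ^+ 2.
have q0 z : 0 <= q z by rewrite addr_ge0// sqr_ge0.
have mq : measurable_fun setT (q : measurableTypeR R -> R).
  by apply: continuous_measurable_fun; have [] := tame_sq.
have C0 : 0 <= C.
  by have := FC 0 0; rewrite expr0n/= addr0 !mulr1; exact: le_trans.
pose g (z : T2) : R := C * q z.1 * q z.2.
have mg : measurable_fun setT (EFin \o g).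
  apply/measurable_EFinP; apply: measurable_funM.
    apply: measurable_funM; first exact: measurable_cst.
    exact: measurableT_comp mq measurable_fst.
  exact: measurableT_comp mq measurable_snd.
have ig : (N \x N)%E.-integrable setT (EFin \o g).
  apply/(integrable12ltyP _ _ mg).
  have -> : (\int[N]_x \int[N]_y `|(EFin \o g) (x, y)| =
      \int[N]_x (C * mean q * q x)%:E)%E.
    apply: eq_integral => x _.
    have -> : (\int[N]_y `|(EFin \o g) (x, y)| = \int[N]_y (C * q x * q y)%:E)%E.
      by apply: eq_integral => y _; rewrite /= ger0_norm// !mulr_ge0.
    have t := tameZ (C * q x) tame_sq.
    by rewrite (integral_tame t) (meanZ _ tame_sq) mulrAC.
  by rewrite (integral_tame (tameZ _ tame_sq)) ltry.
apply: le_integrable ig => //; first exact/measurable_EFinP.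
move=> [x y] _; rewrite /= lee_fin (le_trans (FC x y))//.
exact: ler_norm.
Qed.

Section law.
Variables mu1 mu2 nu11 nu22 nu12 : R.
Local Notation bmap := (binormal_map mu1 mu2 nu11 nu22 nu12).
Local Notation P := (binormal_prob mu1 mu2 nu11 nu22 nu12).

Lemma binormal_integrable F C : measurable_fun setT F ->
  (forall x y, `|F (bmap (x, y))| <= C * (1 + x ^+ 2) * (1 + y ^+ 2)) ->
  P.-integrable setT (EFin \o F).
Proof.
move=> mF FC; have mmap := measurable_binormal_map mu1 mu2 nu11 nu22 nu12.
have mFm : measurable_fun setT (F \o bmap) by exact: measurableT_comp mF mmap.
have mEF : measurable_fun setT (EFin \o F) by exact/measurable_EFinP.
have iF := integrable_normal_prod mFm FC.
exact: (integrable_pushforward mmap mEF iF measurableT).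
Qed.

Lemma binormal_integral F C : measurable_fun setT F ->
  (forall x y, `|F (bmap (x, y))| <= C * (1 + x ^+ 2) * (1 + y ^+ 2)) ->
  (\int[P]_z (F z)%:E = \int[N]_x \int[N]_y (F (bmap (x, y)))%:E)%E.
Proof.
move=> mF FC; have mmap := measurable_binormal_map mu1 mu2 nu11 nu22 nu12.
have mFm : measurable_fun setT (F \o bmap) by exact: measurableT_comp mF mmap.
have mEF : measurable_fun setT (EFin \o F) by exact/measurable_EFinP.
have iF := integrable_normal_prod mFm FC.
apply: etrans (integral_pushforward mmap mEF iF measurableT) _.
exact: esym (integral12_prod_meas1 iF).
Qed.

End law.

Lemma measurable_gelu : measurable_fun setT (@gelu R : measurableTypeR R -> R).
Proof.
by apply: measurable_funM; [exact: measurable_id|exact: measurable_Phi].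
Qed.

Lemma normr_gelu_le x : `|gelu x| <= `|x|.
Proof. by rewrite normrM ler_piMr// ger0_norm ?Phi_ge0 ?Phi_le1. Qed.

Lemma Mact_gelu mu nu : 0 <= nu -> Mact (@gelu R) mu nu = (gelu_mean mu nu)%:E.
Proof.
move=> nu0; rewrite /Mact /gaussian_prob unlock.
(* For zero variance the law is a Dirac mass, and the closed form reduces to [mu * Phi mu]. *)
have [->|nu_neq0] := eqVneq nu 0.
  rewrite /gelu_mean addr0 sqrtr1 divr1 mul0r addr0.
  rewrite integral_dirac//= ?diracT ?mul1e//.
  by apply/measurable_EFinP; exact: measurable_gelu.
have s0 : 0 < Num.sqrt nu by rewrite sqrtr_gt0 lt_neqAle eq_sym nu_neq0.
have tg := tame_gelu_affine mu (Num.sqrt nu).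
have mg : measurable_fun setT (EFin \o @gelu R : measurableTypeR R -> \bar R).
  by apply/measurable_EFinP; exact: measurable_gelu.
transitivity (\int[pushforward N (affine mu (Num.sqrt nu))]_x (gelu x)%:E)%E.
  by apply: eq_measure_integral => A mA _; exact: normal_prob_affine.
have E := integral_pushforward (measurable_affine mu (Num.sqrt nu)) mg
  (tame_integrable tg) measurableT.
apply: etrans E _.
have -> : gelu_mean mu nu = gelu_mean mu (Num.sqrt nu ^+ 2) by rewrite sqr_sqrtr.
by rewrite -mean_gelu; exact: integral_tame.
Qed.

End binormal_expectation.

(* With [U = a + b Z] and [V = c + d Z], the letters [P], [A1 / B], [A2 / D] and
   [C / (B * D)] stand for the expectations of Phi U Phi V, phi U Phi V,
   Phi U phi V and phi U phi V, and [m1], [m2] for those of Z phi U Phi V and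
   Z Phi U phi V. *)
Lemma gelu_moment_identity (F : fieldType) (a b c d g B D P A1 A2 C m1 m2 : F)
  (nu11 := b ^+ 2) (nu12 := b * (g * d)) (mu2 := g * c)
  (nu22 := g ^+ 2 * (1 + d ^+ 2) - 1) :
  g != 0 -> B != 0 -> D != 0 -> 1 + b ^+ 2 != 0 -> 1 + d ^+ 2 != 0 ->
  (1 + b ^+ 2) * m1 = d * (C / (B * D)) - a * b * (A1 / B) ->
  (1 + d ^+ 2) * m2 = b * (C / (B * D)) - c * d * (A2 / D) ->
  g * (a * c * P + ((a * d + b * c) * (b * (A1 / B) + d * (A2 / D)) +
    b * d * (P + (b * m1 + d * m2)))) +
  (g ^+ 2 - 1) / g * (a * (A2 / D) + b * m2) =
  (a * nu12 + mu2 * nu11 - a * nu12 * nu11 / (1 + nu11)) * (1 / B) * A1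
  + (mu2 * nu12 + a * nu22 - mu2 * nu12 * nu22 / (1 + nu22)) * (1 / (g * D)) * A2
  + (nu11 * nu22 + nu12 ^+ 2 * (1 - nu11 / (1 + nu11) - nu22 / (1 + nu22)))
      / (B * (g * D)) * C
  + (a * mu2 + nu12) * P.
Proof.
move=> g0 B0 D0 b0 d0 E1 E2.
have -> : m1 = (d * (C / (B * D)) - a * b * (A1 / B)) / (1 + b ^+ 2).
  by rewrite -E1 mulrC mulKf.
have -> : m2 = (b * (C / (B * D)) - c * d * (A2 / D)) / (1 + d ^+ 2).
  by rewrite -E2 mulrC mulKf.
(* This factors the denominator into quantities assumed nonzero. *)
have -> : 1 + nu22 = g ^+ 2 * (1 + d ^+ 2) by rewrite /nu22; ring.
rewrite /nu11 /nu22 /nu12 /mu2.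
by field; rewrite g0 B0 D0 b0 d0.
Qed.

(** * The covariance of GeLU activations in Cholesky coordinates *)

Section gelu_covariance.
Context {R : realType}.
Local Notation N := (normal_prob (0 : R) 1).
Local Notation phi := (normal_pdf (0 : R) 1).
Local Notation rt b := (Num.sqrt (1 + b ^+ 2)).
Variables mu1 mu2 nu11 nu22 nu12 : R.
Hypothesis hpsd : psdmx (covmx2 nu11 nu22 nu12).
Local Notation P := (binormal_prob mu1 mu2 nu11 nu22 nu12).
Local Notation bmap := (binormal_map mu1 mu2 nu11 nu22 nu12).
Local Notation l1 := (chol11 nu11).
Local Notation l21 := (chol21 nu11 nu12).
Local Notation l22 := (chol22 nu11 nu22 nu12).
Local Notation T2 := (measurableTypeR R * measurableTypeR R)%type.

Let X1 x := mu1 + l1 * x.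
Let X2 x y := mu2 + l21 * x + l22 * y.
(** Given the first coordinate [x], the second component is normal with mean [mu2 + l21 * x] and
    variance [l22 ^+ 2]; [V x] is that mean divided by [g], the argument of [Phi] and [phi] in
    [gelu_mean]. *)
Let g := rt l22.
Let c := mu2 / g.
Let d := l21 / g.
Let V x := c + d * x.
Let F1 (z : T2) : R := gelu z.1.
Let F2 (z : T2) : R := gelu z.2.

Let l1E : l1 ^+ 2 = nu11. Proof. by have [] := cholP hpsd. Qed.
Let l21E : l21 * l1 = nu12. Proof. by have [] := cholP hpsd. Qed.
Let l22E : l21 ^+ 2 + l22 ^+ 2 = nu22. Proof. by have [] := cholP hpsd. Qed.
Let nu11_ge0 : 0 <= nu11. Proof. by rewrite -l1E sqr_ge0. Qed.
Let nu22_ge0 : 0 <= nu22. Proof. by rewrite -l22E addr_ge0// sqr_ge0. Qed.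
Let g0 : 0 < g. Proof. exact: rt_gt0. Qed.
Let g2 : g ^+ 2 = 1 + l22 ^+ 2. Proof. exact: sqr_rt. Qed.
Let D0 : 0 < rt d. Proof. exact: rt_gt0. Qed.
Let B0 : 0 < rt l1. Proof. exact: rt_gt0. Qed.
Let BE : Num.sqrt (1 + nu11) = rt l1. Proof. by rewrite l1E. Qed.

Let nu22E : 1 + nu22 = g ^+ 2 * (1 + d ^+ 2).
Proof.
have -> : g ^+ 2 * (1 + d ^+ 2) = g ^+ 2 + l21 ^+ 2.
  by rewrite /d; field; rewrite gt_eqF.
by rewrite -l22E g2; ring.
Qed.

Let DE : Num.sqrt (1 + nu22) = g * rt d.
Proof. by rewrite nu22E sqrtrM ?sqr_ge0// sqrtr_sqr gtr0_norm. Qed.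

Let sq_bound (z : R) : (1 + `|z|) ^+ 2 <= 2 * (1 + z ^+ 2).
Proof.
rewrite -(real_normK (num_real z)); have := sqr_ge0 (`|z| - 1).
have -> : (`|z| - 1) ^+ 2 = `|z| ^+ 2 - 2 * `|z| + 1 by ring.
have -> : (1 + `|z|) ^+ 2 = `|z| ^+ 2 + 2 * `|z| + 1 by ring.
by lra.
Qed.

(** One crude constant majorising all coefficients of both components. *)
Let k := `|mu1| + `|l1| + (`|mu2| + `|l21| + `|l22|).

Let k0 : 0 <= k. Proof. by rewrite !addr_ge0. Qed.

Let X1_le x : `|X1 x| <= k * (1 + `|x|).
Proof.
apply: le_trans (ler_normD _ _) _; rewrite normrM /k.
have := normr_ge0 mu1; have := normr_ge0 l1; have := normr_ge0 mu2.
have := normr_ge0 l21; have := normr_ge0 l22; have := normr_ge0 x; nra.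
Qed.

Let X2_le x y : `|X2 x y| <= k * (1 + `|x|) * (1 + `|y|).
Proof.
apply: le_trans (ler_normD _ _) _.
apply: le_trans (lerD (ler_normD _ _) (lexx _)) _.
rewrite (normrM l21 x) (normrM l22 y) /k.
have := normr_ge0 mu1; have := normr_ge0 l1; have := normr_ge0 mu2.
have := normr_ge0 l21; have := normr_ge0 l22; have := normr_ge0 x.
have := normr_ge0 y.
move: `|mu1| `|l1| `|mu2| `|l21| `|l22| `|x| `|y| => p1 p2 p3 p4 p5 u v *.
rewrite -subr_ge0.
have -> : (p1 + p2 + (p3 + p4 + p5)) * (1 + u) * (1 + v) - (p3 + p4 * u + p5 * v) =
  (p1 + p2) * (1 + u) * (1 + v) + p3 * (u + v + u * v) +
  p4 * (1 + v + u * v) + p5 * (1 + u + u * v) by ring.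
by rewrite !addr_ge0// !mulr_ge0// !addr_ge0// ?mulr_ge0.
Qed.

Let one_le (z : R) : 1 <= 1 + `|z|. Proof. by rewrite lerDl. Qed.

Let one_le_sq (z : R) : 1 + `|z| <= 2 * (1 + z ^+ 2).
Proof. by apply: le_trans (sq_bound z); rewrite expr2 ler_peMl// addr_ge0. Qed.

Let mF1 : measurable_fun setT F1.
Proof. exact: measurableT_comp measurable_gelu measurable_fst. Qed.

Let mF2 : measurable_fun setT F2.
Proof. exact: measurableT_comp measurable_gelu measurable_snd. Qed.

Let mF12 : measurable_fun setT (fun z => F1 z * F2 z).
Proof. exact: measurable_funM. Qed.

(** The product of the two components grows like [(1 + |x|)^2 (1 + |y|)]; each of these two factors
    costs 2 when replaced by [1 + x^2] or [1 + y^2], whence the 4. *)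
Let bound (t : R) (m : R) x y :
  `|t| <= m * (1 + `|x|) ^+ 2 * (1 + `|y|) -> 0 <= m ->
  `|t| <= 4 * m * (1 + x ^+ 2) * (1 + y ^+ 2).
Proof.
move=> tm m0; apply: le_trans tm _.
have -> : 4 * m * (1 + x ^+ 2) * (1 + y ^+ 2) =
  m * (2 * (1 + x ^+ 2)) * (2 * (1 + y ^+ 2)) by ring.
by rewrite ler_pM ?mulr_ge0 ?sqr_ge0 ?addr_ge0// ler_wpM2l.
Qed.

Let bF1 x y : `|F1 (bmap (x, y))| <= 4 * k * (1 + x ^+ 2) * (1 + y ^+ 2).
Proof.
apply: bound => //; apply: le_trans (normr_gelu_le _) _.
apply: le_trans (X1_le x) _; rewrite -mulrA ler_wpM2l//.
rewrite expr2 -mulrA ler_peMr ?addr_ge0//.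
by rewrite -[X in X <= _]mulr1 ler_pM.
Qed.

Let bF2 x y : `|F2 (bmap (x, y))| <= 4 * k * (1 + x ^+ 2) * (1 + y ^+ 2).
Proof.
apply: bound => //; apply: le_trans (normr_gelu_le _) _.
apply: le_trans (X2_le x y) _; rewrite ler_wpM2r ?addr_ge0// ler_wpM2l//.
by rewrite expr2 ler_peMr ?addr_ge0.
Qed.

Let bF12 x y : `|F1 (bmap (x, y)) * F2 (bmap (x, y))| <=
  4 * (k * k) * (1 + x ^+ 2) * (1 + y ^+ 2).
Proof.
apply: bound; last by rewrite mulr_ge0.
rewrite normrM.
have -> : k * k * (1 + `|x|) ^+ 2 * (1 + `|y|) =
  (k * (1 + `|x|)) * (k * (1 + `|x|) * (1 + `|y|)) by ring.
by rewrite ler_pM//; apply: le_trans (normr_gelu_le _) _;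
  [exact: X1_le|exact: X2_le].
Qed.

(** This is [mean_gelu] with mean [g * V x] and variance [l22 ^+ 2 = g ^+ 2 - 1]. *)
Let inner x : (\int[N]_y (gelu (X2 x y))%:E = (g * gelu (V x) +
  (g ^+ 2 - 1) / g * phi (V x))%:E)%E.
Proof.
rewrite (integral_tame (tame_gelu_affine (mu2 + l21 * x) l22)) mean_gelu.
have VE : (mu2 + l21 * x) / g = V x by rewrite /V /c /d; field; rewrite gt_eqF.
rewrite /gelu_mean -/g VE /gelu -VE g2; congr EFin.
by field; rewrite gt_eqF.
Qed.

Lemma expectation_F1 : ('E_P[F1] = Mact (@gelu R) mu1 nu11)%E.
Proof.
rewrite (Mact_gelu mu1 nu11_ge0) unlock (binormal_integral mF1 bF1).
have -> : (\int[N]_x \int[N]_y (F1 (bmap (x, y)))%:E =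
    \int[N]_x (gelu (X1 x))%:E)%E.
  apply: eq_integral => x _.
  have E := @integral_cst _ _ _ N _ measurableT (gelu (X1 x))%:E.
  apply: etrans E _; rewrite -[RHS]mule1.
  by congr (_ * _)%E; exact: probability_setT.
by rewrite (integral_tame (tame_gelu_affine mu1 l1)) mean_gelu l1E.
Qed.

(** Integrating [inner] over the first coordinate, the coefficients of [phi] add up to
    [(g^2 d^2 + g^2 - 1) / (g * rt d)], which is [nu22 / Num.sqrt (1 + nu22)]. *)
Lemma expectation_F2 : ('E_P[F2] = Mact (@gelu R) mu2 nu22)%E.
Proof.
rewrite (Mact_gelu mu2 nu22_ge0) unlock (binormal_integral mF2 bF2).
under eq_integral do rewrite inner.
have t1 := tame_gelu_affine c d; have t2 := bounded_tame (bounded_std_pdf c d).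
rewrite (integral_tame (tameD (tameZ g t1) (tameZ ((g ^+ 2 - 1) / g) t2))).
rewrite (meanD (tameZ g t1) (tameZ ((g ^+ 2 - 1) / g) t2)).
rewrite (meanZ _ t1) (meanZ _ t2).
rewrite mean_gelu (mean_eq (integral_std_pdf c d)) /gelu_mean DE.
have -> : c / rt d = mu2 / (g * rt d) by rewrite /c; field; rewrite !gt_eqF.
have -> : nu22 = g ^+ 2 * (1 + d ^+ 2) - 1 by rewrite -nu22E; ring.
have -> : mu2 = g * c by rewrite /c; field; rewrite gt_eqF.
by congr EFin; field; rewrite !gt_eqF.
Qed.

Let h1 := mu1 / Num.sqrt (1 + nu11).
Let h2 := mu2 / Num.sqrt (1 + nu22).
Let rho := nu12 / Num.sqrt ((1 + nu11) * (1 + nu22)).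

(** The second coordinate is integrated out by [inner], Stein's identity lowers the remaining
    moments, and [gelu_moment_identity] rearranges them into the stated form. *)
Lemma expectation_gelu_prod :
  ('E_P[(fun z : T2 => gelu z.1 * gelu z.2)%R] =
  ((mu1 * nu12 + mu2 * nu11 - mu1 * nu12 * nu11 / (1 + nu11))
      * (1 / Num.sqrt (1 + nu11)) * Phi21 h1 h2 rho
    + (mu2 * nu12 + mu1 * nu22 - mu2 * nu12 * nu22 / (1 + nu22))
      * (1 / Num.sqrt (1 + nu22)) * Phi21 h2 h1 rho
    + (nu11 * nu22
       + nu12 ^+ 2 * (1 - nu11 / (1 + nu11) - nu22 / (1 + nu22)))
      / Num.sqrt ((1 + nu11) * (1 + nu22)) * phi2 h1 h2 rho
    + (mu1 * mu2 + nu12) * Phi2 h1 h2 rho)%:E)%E.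
Proof.
rewrite unlock; apply: etrans (binormal_integral mF12 bF12) _.
have innerE x : (\int[N]_y (F1 (bmap (x, y)) * F2 (bmap (x, y)))%R%:E =
    (g * (X1 x * Phi (X1 x) * (V x * Phi (V x))) +
     (g ^+ 2 - 1) / g * (X1 x * Phi (X1 x) * phi (V x)))%R%:E)%E.
  have t := tame_gelu_affine (mu2 + l21 * x) l22.
  apply: etrans (integral_tame (tameZ (gelu (X1 x)) t)) _.
  rewrite (meanZ _ t) EFinM -(integral_tame t) inner -EFinM /gelu; congr EFin.
  ring.
have -> : (\int[N]_x \int[N]_y (F1 (bmap (x, y)) * F2 (bmap (x, y)))%R%:E =
  \int[N]_x (g * (X1 x * Phi (X1 x) * (V x * Phi (V x))) +
     (g ^+ 2 - 1) / g * (X1 x * Phi (X1 x) * phi (V x)))%R%:E)%E.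
  by apply: eq_integral => x _; exact: innerE.
have t1 := tame_UPhiVPhi mu1 l1 c d; have t2 := tame_UPhiphi mu1 l1 c d.
rewrite (integral_tame (tameD (tameZ g t1) (tameZ ((g ^+ 2 - 1) / g) t2))).
rewrite (meanD (tameZ g t1) (tameZ ((g ^+ 2 - 1) / g) t2)).
rewrite (meanZ _ t1) (meanZ _ t2).
rewrite mean_UPhiVPhi mean_UPhiphi mean_XPhiPhi mean_X2PhiPhi.
have m1 := mean_XphiPhi mu1 l1 c d.
(* Exchanging the two affine functions gives the moment with [phi] on [V]; [sw] and [swX] later
   restore the order of the factors. *)
have m2 := mean_XphiPhi c d mu1 l1.
(* The factor [g] cancels: [nu12 = l1 * (g * d)] and the second standard deviation is [g * rt d]. *)
have rhoE : rho = l1 * d / (rt l1 * rt d).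
  rewrite /rho sqrtrM ?addr_ge0// BE DE -l21E /d.
  by field; rewrite !gt_eqF.
have h1E : h1 = mu1 / rt l1 by rewrite /h1 BE.
have h2E : h2 = c / rt d by rewrite /h2 DE /c; field; rewrite !gt_eqF.
have sw (f1 f2 : R -> R) :
    mean (fun z => f1 z * f2 z) = mean (fun z => f2 z * f1 z).
  by apply: eq_mean => z; rewrite mulrC.
have PE : mean (fun z => Phi (mu1 + l1 * z) * Phi (c + d * z)) = Phi2 h1 h2 rho.
  by rewrite (mean_eq (integral_PhiPhi mu1 l1 c d)) h1E h2E rhoE.
have A1E : mean (fun z => phi (mu1 + l1 * z) * Phi (c + d * z)) =
    Phi21 h1 h2 rho / rt l1.
  by rewrite (mean_eq (integral_phiPhi mu1 l1 c d)) h1E h2E rhoE.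
have A2E : mean (fun z => phi (c + d * z) * Phi (mu1 + l1 * z)) =
    Phi21 h2 h1 rho / rt d.
  rewrite (mean_eq (integral_phiPhi c d mu1 l1)) h1E h2E rhoE.
  by rewrite (mulrC d l1) (mulrC (rt d) (rt l1)).
have CE : mean (fun z => phi (mu1 + l1 * z) * phi (c + d * z)) =
    phi2 h1 h2 rho / (rt l1 * rt d).
  by rewrite (mean_eq (integral_phiphi mu1 l1 c d)) h1E h2E rhoE.
have swX : mean (fun z => z * (Phi (mu1 + l1 * z) * phi (c + d * z))) =
    mean (fun z => z * (phi (c + d * z) * Phi (mu1 + l1 * z))).
  by apply: eq_mean => z; rewrite (mulrC (Phi _)).
rewrite (sw (fun z => Phi (mu1 + l1 * z)) (fun z => phi (c + d * z))) swX.
move: m1 m2.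
rewrite (sw (fun z => phi (c + d * z)) (fun z => phi (mu1 + l1 * z))).
rewrite PE A1E A2E CE => m1 m2.
have S12 : Num.sqrt ((1 + nu11) * (1 + nu22)) = rt l1 * (g * rt d).
  by rewrite sqrtrM ?addr_ge0// BE DE.
have n12E : nu12 = l1 * (g * d) by rewrite -l21E /d; field; rewrite gt_eqF.
have n22E : nu22 = g ^+ 2 * (1 + d ^+ 2) - 1 by rewrite -nu22E; ring.
have mu2E : mu2 = g * c by rewrite /c; field; rewrite gt_eqF.
have b0 : 1 + l1 ^+ 2 != 0 by rewrite -sqr_rt expf_neq0// gt_eqF.
have d0 : 1 + d ^+ 2 != 0 by rewrite -sqr_rt expf_neq0// gt_eqF.
have K := gelu_moment_identity (Phi2 h1 h2 rho) (lt0r_neq0 g0) (lt0r_neq0 B0)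
  (lt0r_neq0 D0) b0 d0 m1 m2.
rewrite BE DE S12; congr EFin; apply: etrans K _.
by rewrite -n12E -n22E -mu2E l1E.
Qed.

(** The usual covariance formula applies because both activations and their product are integrable,
    by the growth bounds in Cholesky coordinates. *)
Lemma Kact_gelu : (Kact (@gelu R) mu1 mu2 nu11 nu22 nu12 =
  'E_P[(fun z : T2 => gelu z.1 * gelu z.2)%R] -
  Mact (@gelu R) mu1 nu11 * Mact (@gelu R) mu2 nu22)%E.
Proof.
have iL (F : T2 -> R) C : measurable_fun setT F ->
    (forall x y, `|F (bmap (x, y))| <= C * (1 + x ^+ 2) * (1 + y ^+ 2)) ->
    F \in Lfun P 1.
  by move=> mF bF; apply/Lfun1_integrable; exact: binormal_integrable mF bF.
apply: etrans (covarianceE (iL _ _ mF1 bF1) (iL _ _ mF2 bF2)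
  (iL _ _ mF12 bF12)) _.
by rewrite expectation_F1 expectation_F2.
Qed.

End gelu_covariance.

Theorem lemmaD2 (R : realType) (mu1 mu2 nu11 nu22 nu12 : R)
    (hpsd : psdmx (covmx2 nu11 nu22 nu12)) :
  let h1 := mu1 / Num.sqrt (1 + nu11) in
  let h2 := mu2 / Num.sqrt (1 + nu22) in
  let rho := nu12 / Num.sqrt ((1 + nu11) * (1 + nu22)) in
  Kact (@gelu R) mu1 mu2 nu11 nu22 nu12 =
  (((mu1 * nu12 + mu2 * nu11 - mu1 * nu12 * nu11 / (1 + nu11))
      * (1 / Num.sqrt (1 + nu11)) * Phi21 h1 h2 rho
    + (mu2 * nu12 + mu1 * nu22 - mu2 * nu12 * nu22 / (1 + nu22))
      * (1 / Num.sqrt (1 + nu22)) * Phi21 h2 h1 rho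
    + (nu11 * nu22
       + nu12 ^+ 2 * (1 - nu11 / (1 + nu11) - nu22 / (1 + nu22)))
      / Num.sqrt ((1 + nu11) * (1 + nu22)) * phi2 h1 h2 rho
    + (mu1 * mu2 + nu12) * Phi2 h1 h2 rho)%:E
   - Mact (@gelu R) mu1 nu11 * Mact (@gelu R) mu2 nu22)%E.
Proof.
by move=> h1 h2 rho; rewrite Kact_gelu// expectation_gelu_prod.
Qed.
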